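(* Let $K$ be an algebraically closed field of characteristic zero, let $n\ge 1$, and let $F=(F_1,\ldots,F_n):K^n\to K^n$ be a polynomial mapping with $F_i\in K[x_1,\ldots,x_n]$ such that $\det(J_F)=c\in K\setminus\{0\}$, where $J_F=\left[\frac{\partial F_i}{\partial x_j}\right]_{1\le i,j\le n}$. Let $\delta_1,\ldots,\delta_n$ be the Nambu derivations of $K(x_1,\ldots,x_n)$ associated with $F$. For $i,j,k\in\{1,\ldots,n\}$ let $w^k_{ij}\in K[x_1,\ldots,x_n]$ be the generalized wronskian determinant of the $n\times n$ matrix obtained from $[\delta_s x_t]_{1\le s,t\le n}$ (with $s$ the row index and $t$ the column index) by replacing its $j$-th row with the row $(\delta_k\delta_i x_1,\ldots,\delta_k\delta_i x_n)$. Then $F$ is a polynomial automorphism of $K^n$ (that is, $F$ is bijective with polynomial inverse) if and only if $$w^k_{ij}\in K(F_1,\ldots,F_n)\quad\text{for all } i,j,k \text{ with } 1\le i\le k\le n,\ 1\le j\le n,\ (i,j)\ne(k,k).$$ In particular, to decide whether $F$ is a polynomial automorphism it is enough to check that these $\frac12 n^2(n+1)-n$ wronskian determinants belong to $K(F_1,\ldots,F_n)$.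
   Context: The Nambu derivations $\delta_1,\ldots,\delta_n$ are the $K$-derivations of the rational function field $K(x_1,\ldots,x_n)$ defined by $$\begin{pmatrix}\delta_1\\ \vdots\\ \delta_n\end{pmatrix}=(J_F^{-1})^T\begin{pmatrix}\frac{\partial}{\partial x_1}\\ \vdots\\ \frac{\partial}{\partial x_n}\end{pmatrix}.$$ Here $K(F_1,\ldots,F_n)$ denotes the subfield of $K(x_1,\ldots,x_n)$ generated over $K$ by $F_1,\ldots,F_n$. *)

(* Defs.v *)
From HB Require Import structures.
From mathcomp Require Import all_boot all_order all_algebra.
From mathcomp Require Import mpoly ring.

Set Implicit Arguments.
Unset Strict Implicit.
Unset Printing Implicit Defensive.

Import GRing.Theory.
Local Open Scope ring_scope.
Local Open Scope quotient_scope.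

Notation ratfun K n := {fraction {mpoly K[n]}}.
Notation "p %:F" := (@FracField.tofrac _ p) : ring_scope.

Section Partial.
Variables (K : fieldType) (n : nat).
Implicit Types (p q : {mpoly K[n]}) (f g : ratfun K n) (i : 'I_n).

Definition fconst (a : K) : ratfun K n := (a%:MP)%:F.

Definition fvar i : ratfun K n := ('X_i : {mpoly K[n]})%:F.

(* The partial derivative d/dx_i of K(x_1, ..., x_n): quotient rule on a      *)
(* representative.  By [fderiv_frac] the choice of the representative is      *)
(* irrelevant.                                                                *)
Definition fderiv i f : ratfun K n :=
  let p := \n_(repr f) in let q := \d_(repr f) in
  ((p^`M(i) * q - p * q^`M(i))%:F) / (q ^+ 2)%:F.

Lemma frac_repr f : f = (\n_(repr f))%:F / (\d_(repr f))%:F.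
Proof.
have d0 : (\d_(repr f))%:F != 0 :> ratfun K n
  by rewrite tofrac_eq0 denom_ratioP.
apply: (mulIf d0); rewrite mulfVK // -{1}[f]reprK.
move: (repr f) => x; unlock FracField.tofrac.
transitivity (\pi_(FracField.type _) (FracField.mulf x (Ratio \d_x 1))).
  exact/esym/FracField.pi_mul.
apply/eqmodP; rewrite /= FracField.equivfE /FracField.mulf.
rewrite !numden_Ratio ?mulf_neq0 ?oner_neq0 ?denom_ratioP //.
by rewrite !mulr1 mulrC.
Qed.

Lemma fderiv_frac i p q : q != 0 ->
  fderiv i (p%:F / q%:F) = (p^`M(i) * q - p * q^`M(i))%:F / (q ^+ 2)%:F.
Proof.
move=> q0; set f := _ / _; rewrite /fderiv.
have := frac_repr f; rewrite /f; case: (repr _) => [[a b] /= b0] /eqP.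
rewrite eqr_div ?tofrac_eq0 // -!tofracM tofrac_eq => /eqP e.
apply/eqP; rewrite eqr_div ?tofrac_eq0 ?expf_neq0 // -!tofracM tofrac_eq.
have := congr1 (mderiv i) e; rewrite !mderivM => e'; apply/eqP.
have -> : (a^`M(i) * b - a * b^`M(i)) * q ^+ 2 =
   b * q * (a^`M(i) * q + a * q^`M(i)) - (a * q) * (b^`M(i) * q + b * q^`M(i)).
  by ring.
have e2 : p^`M(i) * b + p * b^`M(i) = a^`M(i) * q + a * q^`M(i) := e'.
rewrite -e2 -e; ring.
Qed.

Lemma fderiv_tofrac i p : fderiv i p%:F = (p^`M(i))%:F.
Proof.
rewrite -[p%:F]divr1 -tofrac1 fderiv_frac ?oner_neq0 //.
by rewrite -mpolyC1 mderivC mulr0 subr0 mpolyC1 expr1n mulr1 tofrac1 divr1.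
Qed.

Lemma fderivC i a : fderiv i (fconst a) = 0.
Proof. by rewrite fderiv_tofrac mderivC tofrac0. Qed.

Lemma fderivD i f g : fderiv i (f + g) = fderiv i f + fderiv i g.
Proof.
rewrite (frac_repr f) (frac_repr g).
case: (repr f) => [[a b] /= b0]; case: (repr g) => [[p q] /= q0].
rewrite addf_div ?tofrac_eq0 // -!tofracM -tofracD !fderiv_frac ?mulf_neq0 //.
rewrite addf_div ?tofrac_eq0 ?expf_neq0 // -!tofracM -tofracD.
apply/eqP; rewrite eqr_div ?tofrac_eq0 ?(mulf_neq0, expf_neq0) //.
rewrite -!tofracM tofrac_eq !mderivD !mderivM; apply/eqP; ring.
Qed.

Lemma fderivM i f g : fderiv i (f * g) = fderiv i f * g + f * fderiv i g.
Proof.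
rewrite (frac_repr f) (frac_repr g).
case: (repr f) => [[a b] /= b0]; case: (repr g) => [[p q] /= q0].
rewrite mulf_div -!tofracM !fderiv_frac ?mulf_neq0 // !mulf_div.
rewrite -!tofracM addf_div ?tofrac_eq0 ?(mulf_neq0, expf_neq0) //.
rewrite -!tofracM -tofracD.
apply/eqP; rewrite eqr_div ?tofrac_eq0 ?(mulf_neq0, expf_neq0) //.
rewrite -!tofracM tofrac_eq !mderivM; apply/eqP; ring.
Qed.

End Partial.

(* Prop-valued so that arbitrary, not only decidable, subsets are covered.    *)
Definition is_subfield (L : fieldType) (S : L -> Prop) : Prop :=
  [/\ S 1, forall x y, S x -> S y -> S (x - y)
    & forall x y, S x -> S y -> S (x / y)].

(* Membership in K(F_1, ..., F_n): the smallest subfield of K(x_1, ..., x_n)  *)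
(* containing K and all the F_i.                                              *)
Definition in_gen_subfield (K : fieldType) (n : nat)
    (F : n.-tuple {mpoly K[n]}) (f : ratfun K n) : Prop :=
  forall S : ratfun K n -> Prop, is_subfield S ->
    (forall a : K, S (fconst n a)) -> (forall i, S (tnth F i)%:F) -> S f.

Section Nambu.
Variables (K : fieldType) (n : nat) (F : n.-tuple {mpoly K[n]}).

Definition jacobian : 'M[{mpoly K[n]}]_n := \matrix_(i, j) (tnth F i)^`M(j).

Definition nambu (i : 'I_n) (f : ratfun K n) : ratfun K n :=
  \sum_j ((invmx (map_mx (@FracField.tofrac _) jacobian))^T i j) * fderiv j f.

Definition gen_wronskian_mx (i j k : 'I_n) : 'M[ratfun K n]_n :=
  \matrix_(s, t) if s == j then nambu k (nambu i (fvar K t))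
                 else nambu s (fvar K t).

Definition gen_wronskian (i j k : 'I_n) : ratfun K n :=
  \det (gen_wronskian_mx i j k).

Definition polymap (v : 'rV[K]_n) : 'rV[K]_n :=
  \row_i (tnth F i).@[fun j => v 0 j].

End Nambu.

Definition is_poly_automorphism (K : fieldType) (n : nat)
    (F : n.-tuple {mpoly K[n]}) : Prop :=
  exists G : n.-tuple {mpoly K[n]},
    cancel (polymap F) (polymap G) /\ cancel (polymap G) (polymap F).

(* Main.v *)
(* Let d_1, ..., d_n be the Nambu derivations: they commute, preserve K[x] as
   det J_F is constant, and act on K[F] as the partial derivatives d/dF_i.  The
   matrix M = [d_s x_t] solves the system d_k M = A_k M, where A_k has entries
   c w^k_ij; the missing w^k_kk come from w^k_ij = w^i_kj and from tr A_k = 0.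

   If all w^k_ij lie in K(F), the system depends on F only.  Hence if v1 and v2
   are points (over any extension field) with F(v1) = F(v2), the Taylor
   expansions of x at v1 and v2 in the coordinates F differ by an affine map g
   with g(v1) = v2 and F o g = F.  Such a g is the identity: if it has a fixed
   point, differentiate F o g = F there; otherwise l o g = l + beta for some
   linear form l and beta <> 0, which is impossible since l is algebraic over
   K(F).  So v1 = v2.  Applied to the generic point and to a conjugate of a
   primitive element of K(x) over K(F), this gives K(x) = K(F).

   Finally K[x] and K(F) meet in K[F]: if p is prime in K[y] and p(F) divides
   a(F) but p does not divide a, eliminating one variable between p and a, along
   a direction e in which p is not identically zero at a zero of p(F), gives
   r <> 0 constant along e such that p(F) divides r(F).  This contradicts the
   Leibniz rule at that zero. *)
From HB Require Import structures.
Require Import Defs.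
From mathcomp Require Import all_boot all_order all_algebra all_field.
From mathcomp Require Import perm mpoly ring zify.
From Stdlib Require Import Classical.

Set Implicit Arguments.
Unset Strict Implicit.
Unset Printing Implicit Defensive.

Import GRing.Theory.
Local Open Scope ring_scope.

(** * Nambu derivations on polynomials *)

Lemma mpoly_ring_ind (R : comNzRingType) (n : nat) (P : {mpoly R[n]} -> Prop) :
    (forall c, P c%:MP) -> (forall i, P 'X_i) ->
    (forall p q, P p -> P q -> P (p + q)) ->
    (forall p q, P p -> P q -> P (p * q)) ->
  forall p, P p.
Proof.
move=> PC PX PD PM p; elim/mpolyind: p => [|c m p _ _ Pp].
  by rewrite -(mpolyC0 n).
apply: PD => //; rewrite -mul_mpolyC; apply: (PM _ _ (PC c)).
have P1 : P 1 by rewrite -(mpolyC1 n).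
rewrite mpolyXE_id; apply: (big_ind P P1 PM) => i _.
by elim: (m i) => [|k IH]; rewrite ?expr0 // exprS; apply: PM.
Qed.

Lemma pchar0_natr (K : fieldType) : [pchar K] =i pred0 ->
  forall k : nat, (k.+1)%:R != 0 :> K.
Proof. by move=> ch k; move/pcharf0P: ch => ->. Qed.

Lemma mderiv_eq0_const (K : fieldType) (n : nat) (p : {mpoly K[n]}) :
    [pchar K] =i pred0 -> (forall i, p^`M(i) = 0) -> p = (p@_0%MM)%:MP.
Proof.
move=> ch dp; apply/mpolyP => m; rewrite mcoeffC.
have [->|m0] := eqVneq m 0%MM; first by rewrite mulr1.
have [i mi] : exists i, m i != 0%N.
  apply/existsP; apply: contraR m0; rewrite negb_exists => /forallP h.
  by apply/eqP/mnmP => i; rewrite mnm0E; apply/eqP; move: (h i); rewrite negbK.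
rewrite mulr0; have := congr1 (mcoeff (m - U_(i))%MM) (dp i).
rewrite mcoeff0 mcoeff_deriv submK; last by rewrite lep1mP.
by move/eqP; rewrite -mulr_natr mulf_eq0 (negbTE (pchar0_natr ch _)) orbF => /eqP.
Qed.

Lemma mderiv_msize_lt (K : fieldType) (n : nat) (i : 'I_n) (p : {mpoly K[n]}) :
  p != 0 -> (msize p^`M(i) < msize p)%N.
Proof.
move=> p0; rewrite msizeE big_seq.
elim/big_ind: _ => [|x y|m].
- by rewrite lt0n msize_poly_eq0.
- by rewrite gtn_max => -> ->.
rewrite mcoeff_msupp mcoeff_deriv => h.
have : (m + U_(i))%MM \in msupp p.
  by rewrite mcoeff_msupp; apply: contraNneq h => ->; rewrite mul0rn.
by move/msize_mdeg_lt; rewrite mdegD mdeg1 addn1.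
Qed.

Lemma mderivXU (R : nzRingType) (n : nat) (i j : 'I_n) :
  ('X_j : {mpoly R[n]})^`M(i) = (j == i)%:R.
Proof.
rewrite mderivX mnm1E; case: eqP => [->|_]; last by rewrite scale0r.
by rewrite scale1r -{1}[U_(i)%MM]add0m addmK mpolyX0.
Qed.

Lemma comp_mpolyM (R : comNzRingType) (n k : nat) (q : n.-tuple {mpoly R[k]}) :
  {morph comp_mpoly q : x y / x * y}.
Proof. exact: rmorphM. Qed.

Section NambuPolynomial.
Variables (K : fieldType) (n : nat) (F : n.-tuple {mpoly K[n]}) (c : K).
Hypotheses (charK0 : [pchar K] =i pred0) (c_neq0 : c != 0)
  (detJ : \det (jacobian F) = c%:MP).

Implicit Types (p q f g : {mpoly K[n]}) (i j k : 'I_n).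

(** Since det J_F = c, the inverse Jacobian is c^-1 times the adjugate: these are the Nambu
    derivations on polynomials, as [nambu_tofrac] confirms. *)
Definition mnambu i f : {mpoly K[n]} :=
  \sum_j c^-1 *: (\adj (jacobian F) j i * f^`M(j)).

Local Notation d := mnambu.

Lemma jacobianE i j : jacobian F i j = (tnth F i)^`M(j).
Proof. by rewrite mxE. Qed.

Lemma mnambuD i f g : d i (f + g) = d i f + d i g.
Proof.
by rewrite -big_split; apply: eq_bigr => j _; rewrite mderivD mulrDr scalerDr.
Qed.

Lemma mnambuZ i a f : d i (a *: f) = a *: d i f.
Proof.
rewrite scaler_sumr; apply: eq_bigr => j _.
by rewrite mderivZ -scalerAr !scalerA mulrC.
Qed.

Lemma mnambuC i a : d i a%:MP = 0.
Proof. by apply: big1 => j _; rewrite mderivC mulr0 scaler0. Qed.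

Lemma mnambuN i f : d i (- f) = - d i f.
Proof. by rewrite -scaleN1r mnambuZ scaleN1r. Qed.

Lemma mnambu0 i : d i 0 = 0.
Proof. by rewrite -(mpolyC0 n) mnambuC. Qed.

Lemma mnambu_sum i (I : Type) (r : seq I) (P : pred I) (f : I -> {mpoly K[n]}) :
  d i (\sum_(x <- r | P x) f x) = \sum_(x <- r | P x) d i (f x).
Proof. exact: (big_morph _ (mnambuD i) (mnambu0 i)). Qed.

Lemma mnambuM i f g : d i (f * g) = d i f * g + f * d i g.
Proof.
rewrite mulr_suml mulr_sumr -big_split; apply: eq_bigr => j _ /=.
rewrite mderivM -!mul_mpolyC; ring.
Qed.

Lemma mnambu_component i j : d i (tnth F j) = (i == j)%:R.
Proof.
have := congr1 (fun M : 'M_n => M j i) (mul_mx_adj (jacobian F)).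
rewrite detJ !mxE => e; rewrite /d -scaler_sumr.
transitivity (c^-1 *: (c%:MP *+ (j == i)) : {mpoly K[n]}).
  by rewrite -e; congr (_ *: _); apply: eq_bigr => t _; rewrite jacobianE mulrC.
rewrite eq_sym -mul_mpolyC; case: (i == j); last by rewrite mulr0n mulr0.
by rewrite mulr1n -mpolyCM mulVf // mpolyC1.
Qed.

Lemma mderiv_mnambu j f : f^`M(j) = \sum_i jacobian F i j * d i f.
Proof.
transitivity (c^-1 *: \sum_t (\adj (jacobian F) *m jacobian F) t j * f^`M(t)).
  rewrite mul_adj_mx detJ (bigD1 j) //= big1 => [|t tj].
    by rewrite mxE eqxx addr0 mulr1n -mul_mpolyC mulrA -mpolyCM mulVf // mpolyC1 mul1r.
  by rewrite mxE (negbTE tj) mulr0n mul0r.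
under [RHS]eq_bigr do rewrite mulr_sumr; rewrite exchange_big /= scaler_sumr.
apply: eq_bigr => t _; rewrite mxE mulr_suml scaler_sumr; apply: eq_bigr => i _.
by rewrite -!mul_mpolyC; ring.
Qed.

Lemma mnambu_comp i p : d i (p \mPo F) = p^`M(i) \mPo F.
Proof.
elim/mpoly_ring_ind: p => [a|j|p q hp hq|p q hp hq].
- by rewrite comp_mpolyC mnambuC mderivC comp_mpoly0.
- by rewrite comp_mpolyXU -tnth_nth mnambu_component mderivXU eq_sym rmorph_nat.
- by rewrite comp_mpolyD mnambuD mderivD hp hq comp_mpolyD.
- by rewrite mderivM comp_mpolyD !rmorphM /= mnambuM hp hq.
Qed.

Lemma mnambuE i f : d i f = \sum_t d i 'X_t * f^`M(t).
Proof.
elim/mpoly_ring_ind: f => [a|j|p q hp hq|p q hp hq].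
- by rewrite mnambuC big1 // => t _; rewrite mderivC mulr0.
- rewrite (bigD1 j) //= big1 => [|t tj].
    by rewrite mderivXU eqxx mulr1 addr0.
  by rewrite mderivXU eq_sym (negbTE tj) mulr0.
- by rewrite mnambuD hp hq -big_split; apply: eq_bigr => t _; rewrite mderivD mulrDr.
- rewrite mnambuM hp hq mulr_suml mulr_sumr -big_split.
  by apply: eq_bigr => t _ /=; rewrite mderivM; ring.
Qed.

Lemma mnambu_commute i j f : d i (d j f) = d j (d i f).
Proof.
(* The commutator is a derivation vanishing on every F_s, hence, as J_F is
   invertible, on every coordinate. *)
pose e g := d i (d j g) - d j (d i g).
suff h : e f = 0 by apply/eqP; rewrite -subr_eq0; apply/eqP.
have eM g1 g2 : e (g1 * g2) = e g1 * g2 + g1 * e g2.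
  rewrite /e !mnambuM !mnambuD !mnambuM.
  move: (d i (d j g1)) (d j (d i g1)) (d i (d j g2)) (d j (d i g2)) => x1 y1 x2 y2.
  by move: (d i g1) (d j g1) (d i g2) (d j g2) => *; ring.
have eD g1 g2 : e (g1 + g2) = e g1 + e g2.
  rewrite /e !mnambuD.
  by move: (d i (d j g1)) (d j (d i g1)) (d i (d j g2)) (d j (d i g2)) => *; ring.
have eE g : e g = \sum_t e 'X_t * g^`M(t).
  elim/mpoly_ring_ind: g => [a|s|p q hp hq|p q hp hq].
  - by rewrite /e !(mnambuC, mnambu0) subrr big1 // => t _; rewrite mderivC mulr0.
  - rewrite (bigD1 s) //= big1 => [|t ts].
      by rewrite mderivXU eqxx mulr1 addr0.
    by rewrite mderivXU eq_sym (negbTE ts) mulr0.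
  - by rewrite eD hp hq -big_split; apply: eq_bigr => t _; rewrite mderivD mulrDr.
  - rewrite eM hp hq mulr_suml mulr_sumr -big_split.
    by apply: eq_bigr => t _ /=; rewrite mderivM; ring.
have eF s : e (tnth F s) = 0.
  by rewrite /e !mnambu_component -!mpolyC_nat !mnambuC subrr.
have eX t : e 'X_t = 0.
  have h : (\row_t e 'X_t) *m (jacobian F)^T = 0.
    apply/rowP => s; rewrite !mxE -[RHS](eF s) eE.
    by apply: eq_bigr => u _; rewrite !mxE.
  have := congr1 (fun v => v *m \adj (jacobian F)^T) h.
  rewrite -mulmxA mul_mx_adj det_tr detJ mul0mx mul_mx_scalar => /rowP/(_ t).
  rewrite !mxE => /eqP; rewrite mulf_eq0 mpolyC_eq0 (negbTE c_neq0) /=.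
  by move/eqP.
by rewrite eE big1 // => t _; rewrite eX mul0r.
Qed.

(** Algebraic independence of the F_i: applying d_i to a relation gives one of smaller degree, so by
    induction all partial derivatives of p vanish and p is constant. *)
Lemma comp_mpoly_component_eq0 p : p \mPo F = 0 -> p = 0.
Proof.
have [m] := ubnP (msize p); elim: m p => // m IH p le_pm pF0.
have [->//|p0] := eqVneq p 0.
have h : p = (p@_0%MM)%:MP.
  apply: mderiv_eq0_const => // i; apply: IH.
    exact: leq_trans (mderiv_msize_lt i p0) _.
  by rewrite -mnambu_comp pF0 mnambu0.
by move: pF0; rewrite h comp_mpolyC.
Qed.

Lemma comp_mpoly_component_inj : injective (fun p : {mpoly K[n]} => p \mPo F).
Proof.
move=> p q e; apply/eqP; rewrite -subr_eq0; apply/eqP.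
by apply: comp_mpoly_component_eq0; rewrite comp_mpolyB e subrr.
Qed.

Definition mnambu_word (w : seq 'I_n) f := foldr d f w.

Lemma mnambu_word_rcons w i f :
  mnambu_word (rcons w i) f = mnambu_word w (d i f).
Proof. by rewrite /mnambu_word -cats1 foldr_cat. Qed.

Lemma mnambu_word0 w : mnambu_word w 0 = 0.
Proof. by elim: w => //= i w ->; rewrite mnambu0. Qed.

Lemma mnambu_wordD w f g :
  mnambu_word w (f + g) = mnambu_word w f + mnambu_word w g.
Proof. by elim: w => //= i w ->; rewrite mnambuD. Qed.

(** Faithfulness of the Taylor expansion at v in the coordinates F. *)
Lemma mnambu_word_ext (v : 'I_n -> K) f :
  (forall w, (mnambu_word w f).@[v] = 0) -> f = 0.
Proof.
have [m] := ubnP (msize f); elim: m f => // m IH f le_fm fv.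
have [->//|f0] := eqVneq f 0.
(* The functions all of whose iterated derivatives vanish at v form an ideal
   stable under the Nambu derivations, hence under the partial derivatives. *)
pose Z g := forall w, (mnambu_word w g).@[v] = 0.
have Zd g i : Z g -> Z (d i g).
  by move=> Zg w; rewrite -mnambu_word_rcons.
have ZM g h : Z h -> Z (g * h).
  move=> Zh w; have [k] := ubnP (size w); elim: k w g h Zh => // k IHk w g h Zh.
  case/lastP: w => [_|w i].
    by rewrite /= mevalM (Zh [::]) mulr0.
  rewrite size_rcons ltnS => lt_wk; rewrite mnambu_word_rcons mnambuM mnambu_wordD mevalD IHk // IHk // ?addr0 //; exact: Zd.
have Zs (I : Type) (r : seq I) (g : I -> _) : (forall x, Z (g x)) -> Z (\sum_(x <- r) g x).
  move=> Zg; apply: (big_ind Z) => //.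
  - by move=> w; rewrite mnambu_word0 meval0.
  - by move=> g1 g2 h1 h2 w; rewrite mnambu_wordD mevalD h1 h2 addr0.
have dfx : f = (f@_0%MM)%:MP.
  apply: mderiv_eq0_const => // i; apply: IH.
    exact: leq_trans (mderiv_msize_lt i f0) _.
  by rewrite mderiv_mnambu; apply: Zs => j; apply: ZM; apply: Zd.
by move: (fv [::]); rewrite /= dfx mevalC => ->; rewrite mpolyC0.
Qed.

End NambuPolynomial.

(** * Wronskians *)

(** Jacobi's formula: differentiating the permutation expansion replaces one row at a time by its
    derivative, and each resulting determinant is expanded along that row. *)
Lemma derivation_det (R : comNzRingType) (D : R -> R) (n : nat) (M : 'M[R]_n) :
    {morph D : x y / x + y} -> (forall x y, D (x * y) = D x * y + x * D y) ->
  D (\det M) = \sum_i \sum_t D (M i t) * cofactor M i t.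
Proof.
move=> DD DM.
have D0 : D 0 = 0 by apply: (addIr (D 0)); rewrite -DD !add0r.
have D1 : D 1 = 0 by apply: (addIr (D 1)); rewrite -{3}[1]mul1r DM mulr1 mul1r add0r.
have DN x : D (- x) = - D x.
  by apply/eqP; rewrite -subr_eq0 opprK -DD addNr D0.
have Dsign (b : bool) x : D ((-1) ^+ b * x) = (-1) ^+ b * D x.
  by case: b; rewrite ?expr1 ?mulN1r ?DN // !expr0 !mul1r.
have Dprod (s : {perm 'I_n}) (r : seq 'I_n) : uniq r ->
    D (\prod_(i <- r) M i (s i)) =
    \sum_(i <- r) \prod_(i' <- r) (if i' == i then D (M i' (s i')) else M i' (s i')).
  elim: r => [|a r IH] /=; first by rewrite !big_nil D1.
  case/andP=> ar ur; rewrite !big_cons DM IH // eqxx; congr (_ * _ + _).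
    apply: eq_big_seq => i ir; case: eqP => // ia.
    by rewrite -ia ir in ar.
  rewrite mulr_sumr; apply: eq_big_seq => i ir; rewrite big_cons.
  by case: eqP => // ai; rewrite ai ir in ar.
pose Mi i := \matrix_(s, t) (if s == i then D (M s t) else M s t).
transitivity (\sum_i \det (Mi i)).
  rewrite (big_morph D DD D0) exchange_big /=; apply: eq_bigr => s _.
  rewrite Dsign Dprod ?index_enum_uniq // mulr_sumr; apply: eq_bigr => i _.
  by congr (_ * _); apply: eq_bigr => i' _; rewrite mxE.
apply: eq_bigr => i _; rewrite (expand_det_row _ i); apply: eq_bigr => t _.
rewrite mxE eqxx /cofactor; congr (_ * (_ * \det _)).
by apply/matrixP => a b; rewrite !mxE eq_sym (negbTE (neq_lift _ _)).
Qed.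

Section Wronskian.
Variables (K : fieldType) (n : nat) (F : n.-tuple {mpoly K[n]}) (c : K).
Hypotheses (c_neq0 : c != 0)
  (detJ : \det (jacobian F) = c%:MP).

Local Notation d := (mnambu F c).

(** Expansion of w^k_ij along its replaced row j; the cofactors there are c^-1 dF_j/dx_t
    ([cofactor_M]). *)
Definition mwronskian (i j k : 'I_n) : {mpoly K[n]} :=
  c^-1 *: \sum_t d k (d i 'X_t) * (tnth F j)^`M(t).

Let M : 'M[{mpoly K[n]}]_n := \matrix_(s, t) d s 'X_t.

Let M_jacobian : M *m (jacobian F)^T = 1%:M.
Proof.
apply/matrixP => s j; rewrite !mxE -(mnambu_component c_neq0 detJ) mnambuE.
by apply: eq_bigr => t _; rewrite !mxE.
Qed.

Let det_M : \det M = (c^-1)%:MP.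
Proof.
have := congr1 determinant M_jacobian; rewrite det_mulmx det_tr detJ det1 => e.
by rewrite -[LHS]mulr1 -(mpolyC1 n) -(mulfV c_neq0) mpolyCM mulrA e mul1r.
Qed.

Let cofactor_M j t : cofactor M j t = c^-1 *: (tnth F j)^`M(t).
Proof.
have : \adj M = (c^-1)%:MP *: (jacobian F)^T.
  rewrite -[LHS]mulmx1 -M_jacobian mulmxA mul_adj_mx det_M.
  by rewrite mul_scalar_mx.
by move/matrixP/(_ t j); rewrite !mxE => ->; rewrite mul_mpolyC.
Qed.

Lemma mwronskian_det i j k :
  \det (\matrix_(s, t) if s == j then d k (d i 'X_t) else d s 'X_t)
  = mwronskian i j k.
Proof.
rewrite (expand_det_row _ j) /mwronskian scaler_sumr; apply: eq_bigr => t _.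
rewrite mxE eqxx scalerAr -cofactor_M /cofactor; congr (_ * (_ * \det _)).
by apply/matrixP => a b; rewrite !mxE eq_sym (negbTE (neq_lift _ _)).
Qed.

(** Inserting J^T M = 1 with M = [d_s x_t] yields the linear system d_k M = A_k M. *)
Lemma mnambu_mnambu i k t :
  d k (d i 'X_t) = c *: \sum_j mwronskian i j k * d j 'X_t.
Proof.
have e : (jacobian F)^T *m M = 1%:M by apply: mulmx1C.
transitivity (\sum_u d k (d i 'X_u) * ((jacobian F)^T *m M) u t).
  rewrite e (bigD1 t) //= big1 => [|u ut]; first by rewrite mxE eqxx mulr1 addr0.
  by rewrite mxE (negbTE ut) mulr0.
under eq_bigr do rewrite mxE mulr_sumr; rewrite exchange_big /= scaler_sumr.
apply: eq_bigr => j _; rewrite /mwronskian -scalerAl scalerA mulfV // scale1r.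
by rewrite mulr_suml; apply: eq_bigr => u _; rewrite !mxE mulrA.
Qed.

Lemma mwronskianC i j k : mwronskian i j k = mwronskian k j i.
Proof.
apply: (congr1 (fun s => c^-1 *: s)); apply: eq_bigr => t _.
exact: (congr1 (fun g => g * _) (mnambu_commute c_neq0 detJ k i 'X_t)).
Qed.

(* Apply d_k to the constant det [d_s x_t]. *)
Lemma mwronskian_trace k : \sum_i mwronskian i i k = 0.
Proof.
have /= := derivation_det M (mnambuD F c k) (mnambuM F c k).
rewrite det_M mnambuC => e; rewrite [RHS]e; apply: eq_bigr => i _.
rewrite /mwronskian scaler_sumr; apply: eq_bigr => t _.
by rewrite cofactor_M mxE scalerAr.
Qed.

Lemma nambu_tofrac i (p : {mpoly K[n]}) : nambu F i p%:F = (d i p)%:F.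
Proof.
have cF0 : (c%:MP)%:F != 0 :> ratfun K n by rewrite tofrac_eq0 mpolyC_eq0.
have detJF : \det (map_mx (@FracField.tofrac _) (jacobian F)) = (c%:MP)%:F.
  by rewrite det_map_mx detJ.
rewrite /nambu rmorph_sum; apply: eq_bigr => j _.
rewrite mxE /invmx unitmxE detJF unitfE cF0 mxE -map_mx_adj mxE.
rewrite fderiv_tofrac -mul_mpolyC /= !tofracM mulrA; congr (_ * _ * _).
apply: (mulfI cF0); rewrite mulfV //.
by rewrite -tofracM -mpolyCM mulfV // mpolyC1 tofrac1.
Qed.

Lemma gen_wronskianE i j k : gen_wronskian F i j k = (mwronskian i j k)%:F.
Proof.
rewrite -mwronskian_det -det_map_mx; congr (\det _); apply/matrixP => s t.
by rewrite !mxE /fvar !nambu_tofrac; case: eqP.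
Qed.

End Wronskian.

(** * Algebraic dependence *)

Lemma msizeM_bound (K : fieldType) (n a b : nat) (p q : {mpoly K[n]}) :
  (msize p <= a.+1)%N -> (msize q <= b.+1)%N -> (msize (p * q) <= (a + b).+1)%N.
Proof.
have [->|p0] := eqVneq p 0; first by rewrite mul0r msize0.
have [->|q0] := eqVneq q 0; first by rewrite mulr0 msize0.
by rewrite msizeM //; move: (msize p) (msize q) => x y; lia.
Qed.

Lemma msizeX_bound (K : fieldType) (n a k : nat) (p : {mpoly K[n]}) :
  (msize p <= a.+1)%N -> (msize (p ^+ k) <= (a * k).+1)%N.
Proof.
move=> pa; elim: k => [|k IH]; first by rewrite expr0 msize1.
by rewrite exprS mulnS; apply: msizeM_bound.
Qed.

Lemma card_bmultinom (n b : nat) : (#|{: 'X_{1..n < b}}| <= b ^ n)%N.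
Proof.
have lt_mb (m : 'X_{1..n < b}) (i : 'I_n) : ((m : 'X_{1..n}) i < b)%N.
  by apply: leq_ltn_trans (bmdeg m); rewrite mdegE (bigD1 i) //= leq_addr.
pose f (m : 'X_{1..n < b}) := [ffun i : 'I_n => Ordinal (lt_mb m i)].
have inj_f : injective f.
  move=> m1 m2 /ffunP e; apply/val_inj/mnmP => i.
  by have := congr1 val (e i); rewrite !ffunE.
by have := leq_card f inj_f; rewrite card_ffun !card_ord.
Qed.

(* Linear algebra in the spaces of polynomials of bounded degree: the products
   l^k F^a with exponents less than N are N^(n+1) polynomials of degree O(N). *)
Lemma algebraic_over_components (K : fieldType) (n : nat)
    (F : n.-tuple {mpoly K[n]}) (l : {mpoly K[n]}) :
  exists2 P : {poly {mpoly K[n]}}, P != 0 & (map_poly (comp_mpoly F) P).[l] = 0.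
Proof.
pose d0 := (msize l + \sum_i msize (tnth F i))%N.
(* [d0] bounds the degrees of l and the F_i, so the products have degree less than [b], and b <= N
   e. At most b^n <= (N e)^n monomials occur, fewer than the N^(n+1) products because N > e^n. *)
pose e := (d0 * n.+1).+1; pose N := (e ^ n).+1.
pose T := ('I_N * {ffun 'I_n -> 'I_N})%type.
pose g (x : T) : {mpoly K[n]} := l ^+ x.1 * \prod_i tnth F i ^+ x.2 i.
pose b := (d0 * N * n.+1).+1.
have g_le x : (msize (g x) <= b)%N.
  have bound_l : (msize (l ^+ x.1) <= (d0 * N).+1)%N.
    apply: (@leq_trans (d0 * x.1).+1); first by apply: msizeX_bound; rewrite /d0; lia.
    by rewrite ltnS leq_mul2l (ltnW (ltn_ord _)) orbT.
  rewrite /b mulnS; apply: msizeM_bound => //.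
  have : (msize (\prod_(i <- enum 'I_n) tnth F i ^+ x.2 i) <= (d0 * N * size (enum 'I_n)).+1)%N.
    elim: (enum 'I_n) => [|i r IH]; first by rewrite big_nil msize1.
    rewrite big_cons /= mulnS; apply: msizeM_bound => //.
    apply: (@leq_trans (d0 * x.2 i).+1); last first.
      by rewrite ltnS leq_mul2l (ltnW (ltn_ord _)) orbT.
    apply: msizeX_bound; rewrite /d0 (bigD1 i) //=; lia.
  by rewrite size_enum_ord big_enum.
pose A := \matrix_(r < #|{: T}|, s < #|{: 'X_{1..n < b}}|)
   (g (enum_val r))@_(bmnm (enum_val s)).
have card_lt : (#|{: 'X_{1..n < b}}| < #|{: T}|)%N.
  apply: leq_ltn_trans (card_bmultinom n b) _.
  rewrite card_prod card_ffun !card_ord.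
  apply: (@leq_ltn_trans ((N * e) ^ n)).
    have le_b : (b <= N * e)%N.
      by rewrite /b /e [(N * _)%N]mulnS mulnCA mulnA -add1n leq_add2r.
    by elim: (X in (_ ^ X <= _ ^ X)%N) => // k IH; rewrite !expnS leq_mul.
  by rewrite expnMn mulnC ltn_mul2r expn_gt0 /= /N ltnSn.
have [u u0 uA] : exists2 u : 'rV_#|{: T}|, u != 0 & u *m A = 0.
  have : kermx A != 0.
    rewrite -mxrank_eq0 mxrank_ker subn_eq0 -ltnNge.
    exact: leq_ltn_trans (rank_leq_col A) card_lt.
  by case/rowV0Pn => u /sub_kermxP uA u0; exists u.
pose w (x : T) := u 0 (enum_rank x).
have sum0 : \sum_x w x *: g x = 0.
  apply/mpolyP => m; rewrite mcoeff0 raddf_sum /=.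
  have [lt_mb|le_bm] := ltnP (mdeg m) b.
    have := congr1 (fun M : 'rV_ _ => M 0 (enum_rank (BMultinom lt_mb))) uA.
    rewrite !mxE => e0; rewrite -[RHS]e0 (reindex (fun r : 'I_#|{: T}| => enum_val r)) /=; last first.
      by exists enum_rank => x _; rewrite ?enum_rankK ?enum_valK.
    by apply: eq_bigr => r _; rewrite mcoeffZ !mxE enum_rankK /w enum_valK.
  apply: big1 => x _; rewrite mcoeffZ (_ : _@_m = 0) ?mulr0 //.
  by apply/memN_msupp_eq0/msize_mdeg_ge/(leq_trans (g_le x)).
pose mon (x : T) := [multinom (x.2 i : nat) | i < n].
exists (\sum_x (w x *: 'X_[mon x])%:P * 'X^(x.1)).
  (* Distinct exponents give distinct monomials, so the coefficients of P recover the entries of the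
     relation u. *)
  apply: contraNneq u0 => P0; apply/eqP/rowP => r; rewrite mxE.
  have := congr1 (fun P : {poly {mpoly K[n]}} => P`_(enum_val r).1@_(mon (enum_val r))) P0.
  rewrite coef0 mcoeff0 coef_sum raddf_sum /= (bigD1 (enum_val r)) //= big1.
    by rewrite addr0 coefCM coefXn eqxx mulr1 mcoeffZ mcoeffX eqxx mulr1 /w enum_valK.
  move=> x xr; rewrite coefCM coefXn; case: eqP => [ek|]; last by rewrite mulr0 mcoeff0.
  rewrite mulr1 mcoeffZ mcoeffX; case: eqP => [em|]; last by rewrite mulr0.
  case/eqP: xr; move: ek em; case: x => x1 x2; case: (enum_val r) => y1 y2 /= ek em.
  congr (_, _); first exact/esym/val_inj.
  by apply/ffunP => i; apply/val_inj; move/mnmP/(_ i): em; rewrite !mnmE.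
rewrite rmorph_sum horner_sum -[RHS]sum0; apply: eq_bigr => x _ /=.
rewrite rmorphM /= map_polyC map_polyXn hornerM hornerC hornerXn /= comp_mpolyZ comp_mpolyX.
rewrite /g -scalerAl mulrC; congr (_ *: (_ * _)).
by apply: eq_bigr => i _; rewrite mnmE.
Qed.

(** * Fibres of F *)

Lemma mderiv_comp_mpoly (R : comNzRingType) (n k : nat) (p : {mpoly R[n]})
    (q : n.-tuple {mpoly R[k]}) (s : 'I_k) :
  (p \mPo q)^`M(s) = \sum_t (p^`M(t) \mPo q) * (tnth q t)^`M(s).
Proof.
elim/mpoly_ring_ind: p => [a|j|p1 p2 h1 h2|p1 p2 h1 h2].
- by rewrite comp_mpolyC mderivC big1 // => t _; rewrite mderivC comp_mpoly0 mul0r.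
- rewrite comp_mpolyXU -tnth_nth (bigD1 j) //= big1 => [|t tj].
    by rewrite mderivXU eqxx rmorph1 mul1r addr0.
  by rewrite mderivXU eq_sym (negbTE tj) comp_mpoly0 mul0r.
- rewrite comp_mpolyD mderivD h1 h2 -big_split; apply: eq_bigr => t _.
  by rewrite mderivD comp_mpolyD mulrDl.
- rewrite rmorphM /= mderivM h1 h2 mulr_suml mulr_sumr -big_split.
  apply: eq_bigr => t _ /=.
  by rewrite mderivM comp_mpolyD !rmorphM /=; ring.
Qed.

Lemma comp_mpolyA (R : comNzRingType) (n k m : nat) (p : {mpoly R[n]})
    (q : n.-tuple {mpoly R[k]}) (r : k.-tuple {mpoly R[m]}) :
  (p \mPo q) \mPo r = p \mPo [tuple tnth q i \mPo r | i < n].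
Proof.
elim/mpoly_ring_ind: p => [a|j|p1 p2 h1 h2|p1 p2 h1 h2].
- by rewrite !comp_mpolyC.
- by rewrite !comp_mpolyXU -!tnth_nth tnth_mktuple.
- by rewrite !comp_mpolyD h1 h2.
- by rewrite !rmorphM /= h1 h2.
Qed.

(** On row vectors this is x |-> x C + b. *)
Definition affine_tuple (K : fieldType) (n : nat) (C : 'M[K]_n) (b : 'rV[K]_n) :
    n.-tuple {mpoly K[n]} :=
  [tuple \sum_u C u t *: 'X_u + (b 0 t)%:MP | t < n].

Lemma mderiv_affine_tuple (K : fieldType) (n : nat) (C : 'M[K]_n)
    (b : 'rV[K]_n) s t :
  (tnth (affine_tuple C b) t)^`M(s) = (C s t)%:MP.
Proof.
rewrite tnth_mktuple mderivD mderivC addr0.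
transitivity (\sum_u C u t *: (u == s)%:R : {mpoly K[n]}).
  by rewrite raddf_sum; apply: eq_bigr => u _; rewrite [LHS]mderivZ mderivXU.
rewrite (bigD1 s) //= big1 => [|u us]; last by rewrite (negbTE us) scaler0.
by rewrite eqxx addr0 -mul_mpolyC mulr1.
Qed.

Section Fiber.
Variables (K : fieldType) (n : nat) (F : n.-tuple {mpoly K[n]}) (c : K).
Hypotheses (charK0 : [pchar K] =i pred0) (c_neq0 : c != 0)
  (detJ : \det (jacobian F) = c%:MP).

Local Notation d := (mnambu F c).

Lemma meval_affine_tuple (C : 'M[K]_n) (b : 'rV[K]_n) (v : 'I_n -> K) t :
  (tnth (affine_tuple C b) t).@[v] = ((\row_u v u) *m C + b) 0 t.
Proof.
rewrite tnth_mktuple mevalD mevalC raddf_sum !mxE; congr (_ + _).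
by apply: eq_bigr => u _ /=; rewrite mevalZ mevalXU mxE mulrC.
Qed.

(** The derivative of F o g = F at the fixed point v reads J(v) C^T = J(v) with J(v) invertible, so
    C = 1; then v + b = v. *)
Lemma affine_symmetry_fixpoint (C : 'M[K]_n) (b v : 'rV[K]_n) :
    (forall i, tnth F i \mPo affine_tuple C b = tnth F i) ->
  v *m C + b = v -> C = 1%:M /\ b = 0.
Proof.
move=> FX fix_v.
pose Jv := map_mx (meval (v 0)) (jacobian F).
have Jv_unit : Jv \in unitmx.
  by rewrite unitmxE unitfE det_map_mx detJ /= mevalC.
have JC : Jv *m C^T = Jv.
  apply/matrixP => i s; rewrite [RHS]mxE jacobianE -[tnth F i]FX mderiv_comp_mpoly.
  rewrite raddf_sum mxE; apply: eq_bigr => t _ /=.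
  rewrite mevalM comp_mpoly_meval !mxE; congr (_ * _).
    apply: meval_eq => u; rewrite meval_affine_tuple -{1}fix_v.
    by congr ((_ *m _ + _) _ _); apply/rowP => k; rewrite mxE.
  by rewrite mderiv_affine_tuple mevalC.
have C1 : C = 1%:M.
  by apply: trmx_inj; rewrite trmx1 -[C^T](mulKmx Jv_unit) JC mulVmx.
by split=> //; apply: (addrI v); rewrite addr0 -{1}[v]mulmx1 -C1.
Qed.

Lemma affine_symmetry_trivial (C : 'M[K]_n) (b : 'rV[K]_n) :
    (forall i, tnth F i \mPo affine_tuple C b = tnth F i) ->
  C = 1%:M /\ b = 0.
Proof.
(* A fixed point v of x |-> x C + b is a solution of v (1 - C) = b. *)
move=> FX; have [/submxP [v bE]|] := boolP (b <= 1%:M - C)%MS.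
  apply: (@affine_symmetry_fixpoint _ _ v) => //.
  by rewrite bE mulmxBr mulmx1 addrC subrK.
(* Otherwise some linear form l satisfies l o g = l + beta with beta <> 0, and
   all the l + m beta are roots of an algebraic equation of l over K[F]. *)
rewrite submxE => bcok.
have [j bj] := rV0Pn _ bcok.
(* A column of the cokernel of 1 - C on which b is nonzero: C la = la, so l o g - l is the nonzero
   constant [be]. *)
pose la := col j (cokermx (1%:M - C)); pose be := (b *m cokermx (1%:M - C)) 0 j.
have Cla : C *m la = la.
  apply/esym/eqP; rewrite -subr_eq0 -{1}[la]mul1mx -mulmxBl.
  by rewrite /la colE mulmxA mulmx_coker mul0mx.
pose l : {mpoly K[n]} := \sum_u la u 0 *: 'X_u.
have lX : l \mPo affine_tuple C b = l + be%:MP.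
  rewrite raddf_sum /=.
  under eq_bigr => t _ do rewrite comp_mpolyZ comp_mpolyXU -tnth_nth tnth_mktuple scalerDr scaler_sumr.
  rewrite big_split /= exchange_big /=; congr (_ + _).
    apply: eq_bigr => u _; rewrite -{2}Cla mxE scaler_suml.
    by apply: eq_bigr => t _; rewrite scalerA mulrC.
  rewrite /be mxE raddf_sum; apply: eq_bigr => t _ /=.
  by rewrite -mul_mpolyC -mpolyCM mulrC /la mxE.
have [P P0 Pl] := algebraic_over_components F l.
set PF := map_poly _ P in Pl.
have PF0 : PF != 0.
  by rewrite map_poly_eq0_id0 // -(rmorph0 (comp_mpoly F)) (inj_eq (comp_mpoly_component_inj charK0 c_neq0 detJ)) lead_coef_eq0.
(* The substitution g fixes the coefficients of PF, which are polynomials in F, so it maps roots to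
   roots. *)
have step f : PF.[f] = 0 -> PF.[f \mPo affine_tuple C b] = 0.
  move=> Pf; have := congr1 (comp_mpoly (affine_tuple C b)) Pf.
  rewrite comp_mpoly0 -horner_map /= /PF -map_poly_comp /=.
  rewrite (eq_map_poly (g := comp_mpoly F)) // => p /=.
  rewrite comp_mpolyA; congr (_ \mPo _); apply: eq_from_tnth => i.
  by rewrite tnth_mktuple FX.
have root_m m : PF.[l + (be *+ m)%:MP] = 0.
  elim: m => [|m IH]; first by rewrite mulr0n mpolyC0 addr0.
  have := step _ IH; rewrite comp_mpolyD comp_mpolyC lX.
  by rewrite -addrA -mpolyCD -mulrS.
(* In characteristic zero the values l + m be are distinct, which is too many roots for PF. *)
suff inj : injective (fun m : nat => l + (be *+ m)%:MP).
  suff : (size PF < size PF)%N by rewrite ltnn.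
  rewrite -{1}(size_iota 0 (size PF)) -(size_map (fun m : nat => l + (be *+ m)%:MP)).
  apply: max_poly_roots; rewrite ?map_inj_uniq ?iota_uniq //.
  by apply/allP => _ /mapP[m _ ->]; apply/eqP/root_m.
move=> m1 m2 /addrI/eqP; rewrite mpolyC_eq.
wlog le12 : m1 m2 / (m1 <= m2)%N => [hw|].
  by case: (leqP m1 m2) => [/hw//|/ltnW/hw h e]; apply/esym/h; rewrite eq_sym.
rewrite eq_sym -subr_eq0 -mulrnBr // -mulr_natr mulf_eq0 (negbTE bj) /=.
case e: (m2 - m1)%N => [|k]; last by rewrite (negbTE (pchar0_natr charK0 k)).
by move=> _; apply/eqP; rewrite eqn_leq le12 -subn_eq0 e.
Qed.

Variables (v1 v2 : 'I_n -> K).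

(* Equality up to order m of the Taylor expansions of f at v1 and of g at v2,
   both written in the coordinates F. *)
Fixpoint jet_eq (m : nat) (f g : {mpoly K[n]}) : Prop :=
  f.@[v1] = g.@[v2] /\
  if m is m'.+1 then forall i, jet_eq m' (d i f) (d i g) else True.

Lemma jet_eq_meval m f g : jet_eq m f g -> f.@[v1] = g.@[v2].
Proof. by case: m => [|m] []. Qed.

Lemma jet_eqW m f g : jet_eq m.+1 f g -> jet_eq m f g.
Proof.
elim: m f g => [|m IH] f g [fg h]; split=> // i.
by apply: IH; apply: h.
Qed.

Lemma jet_eqD m f1 f2 g1 g2 :
  jet_eq m f1 g1 -> jet_eq m f2 g2 -> jet_eq m (f1 + f2) (g1 + g2).
Proof.
elim: m f1 f2 g1 g2 => [|m IH] f1 f2 g1 g2 [e1 h1] [e2 h2]; split=> //.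
- by rewrite !mevalD e1 e2.
- by rewrite !mevalD e1 e2.
- by move=> i; rewrite !mnambuD; apply: IH; [apply: h1 | apply: h2].
Qed.

Lemma jet_eqM m f1 f2 g1 g2 :
  jet_eq m f1 g1 -> jet_eq m f2 g2 -> jet_eq m (f1 * f2) (g1 * g2).
Proof.
elim: m f1 f2 g1 g2 => [|m IH] f1 f2 g1 g2 h1 h2.
  by split=> //; rewrite !mevalM (jet_eq_meval h1) (jet_eq_meval h2).
split; first by rewrite !mevalM (jet_eq_meval h1) (jet_eq_meval h2).
move=> i; rewrite !mnambuM; apply: jet_eqD.
  by apply: IH; [case: h1 => _; apply | apply: jet_eqW].
by apply: IH; [apply: jet_eqW | case: h2 => _; apply].
Qed.

Lemma jet_eqC m a : jet_eq m a%:MP a%:MP.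
Proof.
elim: m a => [|m IH] a; split=> //; rewrite ?mevalC // => i.
by rewrite mnambuC -(mpolyC0 n); apply: IH.
Qed.

Lemma jet_eqZ m a f g : jet_eq m f g -> jet_eq m (a *: f) (a *: g).
Proof. by move=> h; rewrite -!mul_mpolyC; apply: jet_eqM => //; apply: jet_eqC. Qed.

Lemma jet_eqN m f g : jet_eq m f g -> jet_eq m (- f) (- g).
Proof. by rewrite -[- f]scaleN1r -[- g]scaleN1r; apply: jet_eqZ. Qed.

Lemma jet_eq_sum m (I : Type) (r : seq I) (f g : I -> {mpoly K[n]}) :
  (forall x, jet_eq m (f x) (g x)) ->
  jet_eq m (\sum_(x <- r) f x) (\sum_(x <- r) g x).
Proof.
move=> h; elim: r => [|x r IH]; last by rewrite !big_cons; apply: jet_eqD.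
by rewrite !big_nil -(mpolyC0 n); apply: jet_eqC.
Qed.

(** By Leibniz h d_i f = d_i (h f) - (d_i h) f, so each order follows from the lower ones after
    division by h1(v1). This passes from h(F) w = a(F) to the jets of the wronskians. *)
Lemma jet_eq_div m h1 h2 f g : h1.@[v1] != 0 ->
  jet_eq m h1 h2 -> jet_eq m (h1 * f) (h2 * g) -> jet_eq m f g.
Proof.
move=> h10; elim: m f g => [|m IH] f g hh hfg.
  have := jet_eq_meval hfg; rewrite !mevalM -(jet_eq_meval hh) => /(mulfI h10).
  by split.
have fg : jet_eq m f g by apply: IH; apply: jet_eqW.
split; first exact: jet_eq_meval fg.
move=> i; case: hfg => _ /(_ i); rewrite !mnambuM => e.
apply: IH; first exact: jet_eqW.
have -> : h1 * d i f = d i h1 * f + h1 * d i f + - (d i h1 * f) by ring.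
have -> : h2 * d i g = d i h2 * g + h2 * d i g + - (d i h2 * g) by ring.
apply: jet_eqD => //; apply/jet_eqN/jet_eqM => //.
by case: hh => _; apply.
Qed.

(** Nambu derivatives of polynomials in F are again polynomials in F, hence take equal values at v1
    and v2. *)
Lemma jet_eq_comp m p : (forall i, (tnth F i).@[v1] = (tnth F i).@[v2]) ->
  jet_eq m (p \mPo F) (p \mPo F).
Proof.
move=> Fv; have pv q : (q \mPo F).@[v1] = (q \mPo F).@[v2].
  by rewrite !comp_mpoly_meval; apply: meval_eq.
elim: m p => [|m IH] p; split=> // i.
by rewrite mnambu_comp.
Qed.

Lemma jet_eq_word m f g w : (size w <= m)%N -> jet_eq m f g ->
  (mnambu_word F c w f).@[v1] = (mnambu_word F c w g).@[v2].
Proof.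
elim: m w f g => [|m IH] w f g.
  by rewrite leqn0 size_eq0 => /eqP -> [].
case/lastP: w => [_ [] //|w i]; rewrite size_rcons ltnS => le_wm [_ h].
by rewrite !mnambu_word_rcons; apply: IH (h i).
Qed.

Variables (h : {mpoly K[n]}) (a : 'I_n -> 'I_n -> 'I_n -> {mpoly K[n]}).
Hypothesis wronskian_rational :
  forall i j k, (h \mPo F) * mwronskian F c i j k = a i j k \mPo F.

(* The Taylor expansions X1, X2 of x at v1 and v2 solve the same linear system,
   so X2 = X1 C + b with C, b constant; then x |-> x C + b preserves F. *)
Lemma fiber_trivial : (forall i, (tnth F i).@[v1] = (tnth F i).@[v2]) ->
  (h \mPo F).@[v1] != 0 -> v1 =1 v2.
Proof.
move=> Fv hv.
have w_jet m i j k : jet_eq m (mwronskian F c i j k) (mwronskian F c i j k).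
  apply: (jet_eq_div hv (jet_eq_comp m h Fv)).
  by rewrite wronskian_rational; apply: jet_eq_comp.
pose J1 := map_mx (meval v1) (jacobian F).
pose M (v : 'I_n -> K) := \matrix_(i, t) (d i 'X_t).@[v].
have MJ : M v1 *m J1^T = 1%:M.
  apply/matrixP => i j; rewrite mxE.
  have := congr1 (meval v1) (mnambu_component c_neq0 detJ i j).
  rewrite mnambuE raddf_sum mxE => e; transitivity ((i == j)%:R : {mpoly K[n]}).@[v1].
    by rewrite -e; apply: eq_bigr => t _; rewrite /= !mxE mevalM.
  by rewrite rmorph_nat.
(* C matches the initial values, M(v1) C = M(v2), and b makes the affine map send v1 to v2. *)
pose C := J1^T *m M v2.
have MC : M v1 *m C = M v2 by rewrite mulmxA MJ mul1mx.
pose b := \row_t v2 t - (\row_t v1 t) *m C.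
(* Uniqueness for the linear system, order by order: M C at v1 and M at v2 have the same values, and
   the system expresses their derivatives through the wronskians and jets of lower order. *)
have dM_jet m i t : jet_eq m (\sum_u C u t *: d i 'X_u) (d i 'X_t).
  elim: m i t => [|m IH] i t.
    split=> //; have := congr1 (fun A : 'M_n => A i t) MC; rewrite !mxE => <-.
    by rewrite raddf_sum; apply: eq_bigr => u _; rewrite /= mevalZ mulrC [M v1 i u]mxE.
  split; first exact: jet_eq_meval (IH i t).
  move=> k; rewrite mnambu_sum (mnambu_mnambu c_neq0 detJ i k t).
  have -> : \sum_u d k (C u t *: d i 'X_u) =
      c *: \sum_j mwronskian F c i j k * (\sum_u C u t *: d j 'X_u).
    under eq_bigr => u _ do rewrite mnambuZ (mnambu_mnambu c_neq0 detJ i k u) scalerA mulrC -scalerA scaler_sumr.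
    rewrite -scaler_sumr exchange_big /=; congr (_ *: _); apply: eq_bigr => j _.
    by rewrite mulr_sumr; apply: eq_bigr => u _; rewrite scalerAr.
  by apply/jet_eqZ/jet_eq_sum => j; apply: jet_eqM.
have X_jet m t : jet_eq m (tnth (affine_tuple C b) t) 'X_t.
  have Xv : (tnth (affine_tuple C b) t).@[v1] = ('X_t : {mpoly K[n]}).@[v2].
    by rewrite meval_affine_tuple /b addrC subrK mevalXU mxE.
  case: m => [|m]; split=> // i; rewrite tnth_mktuple mnambuD mnambuC addr0 mnambu_sum.
  by under eq_bigr => u _ do rewrite mnambuZ; apply: dM_jet.
have f_jet m f : jet_eq m (f \mPo affine_tuple C b) f.
  elim/mpoly_ring_ind: f => [x|t|f g hf hg|f g hf hg].
  - by rewrite comp_mpolyC; apply: jet_eqC.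
  - by rewrite comp_mpolyXU -tnth_nth; apply: X_jet.
  - by rewrite comp_mpolyD; apply: jet_eqD.
  - by rewrite rmorphM; apply: jet_eqM.
(* The jet of F_i o g at v1 is that of F_i at v2, hence that of F_i at v1. *)
have FX i : tnth F i \mPo affine_tuple C b = tnth F i.
  apply/eqP; rewrite -subr_eq0; apply/eqP.
  apply: (mnambu_word_ext charK0 c_neq0 detJ (v := v1)) => w.
  have FF : jet_eq (size w) (tnth F i) (tnth F i).
    by have := jet_eq_comp (size w) 'X_i Fv; rewrite comp_mpolyXU -tnth_nth.
  have := jet_eqD (f_jet (size w) (tnth F i)) (jet_eqN FF).
  by move/(jet_eq_word (leqnn _)) => ->; rewrite subrr mnambu_word0 meval0.
have [C1 b0] := affine_symmetry_trivial FX.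
move=> t; have /rowP/(_ t) : \row_t v2 t - (\row_t v1 t) *m C = 0 by [].
by rewrite C1 mulmx1 !mxE => /eqP; rewrite subr_eq0 => /eqP.
Qed.

End Fiber.

(** * Unique factorization *)

Definition rdvd (A : comNzRingType) (p q : A) : Prop := exists k, q = k * p.

Definition rprime (A : comNzRingType) (p : A) : Prop :=
  [/\ p != 0, ~ rdvd p 1
    & forall x y, rdvd p (x * y) -> rdvd p x \/ rdvd p y].

(** Factors are required to be prime, not merely irreducible, so uniqueness is built in; [rdvd u 1]
    says that u is a unit. *)
Definition factorial (A : comNzRingType) : Prop :=
  forall a : A, a != 0 -> exists u s,
    [/\ rdvd u 1, forall p, p \in s -> rprime p & a = u * \prod_(p <- s) p].

Section Divisibility.
Variable A : comNzRingType.
Implicit Types (p q x y : A).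

Lemma rdvd_mulr p x y : rdvd p x -> rdvd p (x * y).
Proof. by case=> k ->; exists (k * y); rewrite mulrAC. Qed.

Lemma rdvd_mull p x y : rdvd p y -> rdvd p (x * y).
Proof. by rewrite mulrC; apply: rdvd_mulr. Qed.

Lemma rdvdD p x y : rdvd p x -> rdvd p y -> rdvd p (x + y).
Proof. by move=> [k ->] [l ->]; exists (k + l); rewrite mulrDl. Qed.

Lemma rdvdN p x : rdvd p x -> rdvd p (- x).
Proof. by case=> k ->; exists (- k); rewrite mulNr. Qed.

Lemma rprime_mul p x y : rprime p -> rdvd p (x * y) -> rdvd p x \/ rdvd p y.
Proof. by case=> _ _; apply. Qed.

Lemma rdvd_mul_unit p u x : rdvd u 1 -> rdvd p (u * x) -> rdvd p x.
Proof.
by move=> [v uv] h; rewrite -[x]mul1r uv -mulrA; apply: rdvd_mull.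
Qed.

Lemma rprime_prod p s : rprime p -> rdvd p (\prod_(q <- s) q) ->
  exists2 q, q \in s & rdvd p q.
Proof.
case=> _ p1 pM; elim: s => [|q s IH]; first by rewrite big_nil.
rewrite big_cons => /pM[h|/IH[r rs h]]; first by exists q; rewrite ?mem_head.
by exists r; rewrite // inE rs orbT.
Qed.

End Divisibility.

(** * Gauss's theorem on polynomial rings over factorial domains *)

Section Factorial.
Variable A : idomainType.
Implicit Types (a p q : A) (f g h k : {poly A}).

Lemma rdvd_polyC_coef p f : rdvd p%:P f <-> forall i, rdvd p f`_i.
Proof.
split=> [[k ->] i|h]; first by exists k`_i; rewrite coefMC.
elim/poly_ind: f h => [_|f c IH h]; first by exists 0; rewrite mul0r.
apply: rdvdD.
  apply/rdvd_mulr/IH => i.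
  by have := h i.+1; rewrite coefD coefMX coefC addr0.
have [k ek] := h 0%N; exists k%:P; move: ek.
by rewrite coefD coefMX coefC /= add0r -polyCM => ->.
Qed.

(** Gauss's lemma. p divides f_0 g_0, so by symmetry it may be assumed to divide f_0; removing the
    constant term of f and dividing by X lowers the size. *)
Lemma rprime_polyC p : rprime p -> rprime p%:P.
Proof.
case=> p0 p1 pM; split; first by rewrite polyC_eq0.
  by move/rdvd_polyC_coef/(_ 0%N); rewrite coef1.
move=> f g; have [m] := ubnP (size f + size g).
elim: m f g => // m IH f g.
wlog : f g / rdvd p f`_0 => [hw|pf0].
  move=> le_m pfg; have /pM[pf|pg] : rdvd p (f`_0 * g`_0).
  - by move/rdvd_polyC_coef/(_ 0%N): pfg; rewrite coefM big_ord1 subn0.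
  - exact: hw.
  - by rewrite or_comm; apply: hw; rewrite 1?addnC 1?mulrC.
have [f' ef] : exists f', f = f' * 'X + (f`_0)%:P.
  elim/poly_ind: (f) => [|f1 c _]; first by exists 0; rewrite mul0r coef0 addr0.
  by exists f1; rewrite coefD coefMX coefC add0r.
have [f'0|f'0] := eqVneq f' 0.
  move=> _ _; left; apply/rdvd_polyC_coef => i.
  rewrite ef f'0 mul0r add0r coefC; case: eqP => // _.
  by exists 0; rewrite mul0r.
move=> le_m pfg; have pf0C : rdvd p%:P (f`_0)%:P.
  by case: pf0 => k ->; exists k%:P; rewrite polyCM.
have pf'g : rdvd p%:P (f' * g).
  apply/rdvd_polyC_coef => i.
  have /rdvd_polyC_coef/(_ i.+1) : rdvd p%:P (f' * 'X * g).
    have -> : f' * 'X * g = f * g + - ((f`_0)%:P * g) by rewrite {1}ef; ring.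
    by apply/rdvdD/rdvdN/rdvd_mulr.
  by rewrite mulrAC coefMX.
have [|pf'|] := IH f' g _ pf'g; last by right.
  by move: le_m; rewrite ef size_MXaddC (negbTE f'0) /=.
by left; rewrite ef; apply: rdvdD => //; apply: rdvd_mulr.
Qed.

Hypothesis factA : factorial A.

Definition primitive f := forall p, rprime p -> ~ rdvd p%:P f.

(** The primes of a are cancelled one by one: each divides k f, hence k, as f is primitive. *)
Lemma primitive_cancel f g k a :
  primitive f -> a != 0 -> a *: g = k * f -> rdvd f g.
Proof.
move=> prim_f /factA[u [s [u1 ps ->]]].
elim: s k ps => [|p s IH] k ps.
  rewrite big_nil mulr1; case: u1 => v uv e; exists (v *: k).
  by rewrite -scalerAl -e scalerA -uv scale1r.
rewrite big_cons => e.
have pp : rprime p by apply: ps; rewrite mem_head.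
have : rdvd p%:P (k * f).
  rewrite -e; exists ((u * \prod_(q <- s) q) *: g).
  by rewrite [RHS]mulrC mul_polyC scalerA; congr (_ *: _); ring.
case/(rprime_mul (rprime_polyC pp)) => [[k' ek]|/(prim_f p pp)] //.
apply: (IH k'); first by move=> q qs; apply: ps; rewrite inE qs orbT.
have pC0 : p%:P != 0 :> {poly A} by rewrite polyC_eq0; case: pp.
apply: (mulfI pC0); rewrite [RHS]mulrA [p%:P * k']mulrC -ek -e mul_polyC scalerA.
by congr (_ *: _); ring.
Qed.

(** Primes are pulled out of f while there are any. This ends because each is associated to a prime
    factor of the leading coefficient. *)
Lemma primitive_decomposition f : f != 0 -> exists s f',
  [/\ forall p, p \in s -> rprime p, primitive f'
    & f = (\prod_(p <- s) p)%:P * f'].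
Proof.
move=> f0; have [u [s [u1 ps lcf]]] : exists u s, [/\ rdvd u 1, forall p, p \in s -> rprime p
    & rdvd (lead_coef f) (u * \prod_(p <- s) p)].
  have lc0 : lead_coef f != 0 by rewrite lead_coef_eq0.
  have [u [s [u1 ps e]]] := factA lc0.
  by exists u, s; split=> //; rewrite e; exists 1; rewrite mul1r.
have [m] := ubnP (size s); elim: m s u f f0 u1 ps lcf => // m IH s u f f0 u1 ps lcf.
case: (classic (primitive f)) => [prim_f _|nprim le_m].
  by exists [::], f; split=> //; rewrite big_nil mul1r.
have [q nq] := not_all_ex_not _ _ nprim.
have [pq /NNPP[f1 ef]] := imply_to_and _ _ nq.
have f10 : f1 != 0 by apply: contraNneq f0 => e; rewrite ef e mul0r.
have q0 : q != 0 by case: pq.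
have lc_f : lead_coef f = lead_coef f1 * q by rewrite ef lead_coefM lead_coefC.
have [p p_s [k epk]] : exists2 p, p \in s & rdvd q p.
  apply: rprime_prod => //; apply: (rdvd_mul_unit u1).
  by case: lcf => y ->; rewrite lc_f mulrA; exists (y * lead_coef f1).
(* p = k q with p and q prime, so k is a unit and can be absorbed into u. *)
have k1 : rdvd k 1.
  have [p0 p1 pM] := ps p p_s.
  have /pM[[l el]|[l el]] : rdvd p (k * q) by rewrite -epk; exists 1; rewrite mul1r.
    case: pq => _ []; exists l; apply: (mulfI p0).
    by rewrite {1}epk el; ring.
  exists l; apply: (mulfI q0); rewrite {1}el epk; ring.
have [||||s' [f' [ps' prim_f' ef1]]] := IH (rem p s) (u * k) f1 f10.
- by case: u1 k1 => [v uv] [l lk]; exists (v * l); rewrite -[1]mulr1 {1}uv lk; ring.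
- by move=> r /mem_rem/ps.
- case: lcf => y; rewrite (perm_big _ (perm_to_rem p_s)) big_cons lc_f => e.
  exists y; move: e => /=; set P := \prod_(j <- rem p s) j => e.
  apply: (mulfI q0); have -> : q * (y * lead_coef f1) = y * (lead_coef f1 * q) by ring.
  by rewrite -e epk; ring.
- by rewrite size_rem //; move: le_m p_s; case: (s).
exists (q :: s'), f'; split=> //.
  by move=> r; rewrite inE => /predU1P[->|/ps'].
by rewrite ef ef1 big_cons polyCM; ring.
Qed.

(** [dvdp] is divisibility over the fraction field, where Euclid's lemma holds for f;
    [primitive_cancel] brings the conclusion back to A[X]. *)
Lemma rprime_primitive_irreducible f :
  primitive f -> Pdiv.Idomain.irreducible_poly f -> rprime f.
Proof.
move=> prim_f irr_f; have f_gt1 : (1 < size f)%N by case: irr_f.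
have f0 : f != 0 by rewrite -size_poly_gt0 ltnW.
have cancel_f g : Pdiv.Idomain.dvdp f g -> rdvd f g.
  by case/Pdiv.Idomain.dvdpP => [[a k] /= a0 e]; apply: primitive_cancel e.
split=> // [[k /(congr1 (fun q : {poly A} => size q)) /=]|g h [k e]].
  have [->|k0] := eqVneq k 0; first by rewrite mul0r size_poly0 size_poly1.
  by rewrite size_poly1 size_mul //; move: k0 f_gt1; rewrite -size_poly_gt0; move: (size k) (size f) => x y; lia.
have [co|nco] := boolP (Pdiv.Idomain.coprimep f g); last first.
  by left; apply: cancel_f; move: nco; rewrite irreducible_poly_coprime ?negbK.
right; apply: cancel_f; rewrite -(Pdiv.Idomain.Gauss_dvdpr _ co) e.
exact: Pdiv.Idomain.dvdp_mull.
Qed.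

(** Clears the denominator of a factorization over the fraction field: by Gauss's lemma each prime
    of a divides g or h. *)
Lemma factorial_scale_split a f g h : a != 0 -> a *: f = g * h ->
  exists g' h', [/\ size g' = size g, size h' = size h & f = g' * h'].
Proof.
move=> /factA[u [s [u1 ps ->]]]; elim: s g h ps => [|p s IH] g h ps.
  rewrite big_nil mulr1; case: u1 => v uv e; exists (v *: g), h.
  rewrite -scalerAl -e scalerA -uv scale1r; split=> //.
  by apply: size_scale; apply: contraTneq isT => v0; move/eqP: uv; rewrite v0 mul0r oner_eq0.
rewrite big_cons => e.
have pp : rprime p by apply: ps; rewrite mem_head.
have p0 : p != 0 by case: pp.
have pC0 : p%:P != 0 :> {poly A} by rewrite polyC_eq0.
have ps' q : q \in s -> rprime q by move=> qs; apply: ps; rewrite inE qs orbT.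
have e' : p%:P * ((u * \prod_(q <- s) q) *: f) = g * h.
  by rewrite -e mul_polyC scalerA; congr (_ *: _); ring.
have szC k : size (k * p%:P) = size k by rewrite mulrC mul_polyC size_scale.
have : rdvd p%:P (g * h) by rewrite -e'; apply/rdvd_mulr; exists 1; rewrite mul1r.
case/(rprime_mul (rprime_polyC pp)) => [[k ek]|[k ek]].
  have [|g' [h' [sg sh ef]]] := IH k h ps'.
    by apply: (mulfI pC0); rewrite e' ek; ring.
  by exists g', h'; rewrite ek szC.
have [|g' [h' [sg sh ef]]] := IH g k ps'.
  by apply: (mulfI pC0); rewrite e' ek; ring.
by exists g', h'; rewrite ek szC.
Qed.

Lemma factorial_poly : factorial {poly A}.
Proof.
move=> f; have [m] := ubnP (size f); elim: m f => // m IH f le_m f0.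
have [f_gt1|f_le1] := ltnP 1 (size f); last first.
  have fc0 : f`_0 != 0 by move: f0; rewrite {1}(size1_polyC f_le1) polyC_eq0.
  have [u [s [u1 ps e]]] := factA fc0.
  exists u%:P, [seq p%:P | p <- s]; split.
  - by case: u1 => v uv; exists v%:P; rewrite -polyCM -uv.
  - by move=> _ /mapP[p /ps pp ->]; apply: rprime_polyC.
  - by rewrite big_map -rmorph_prod -polyCM -e; apply: size1_polyC.
(* Irreducibility is over the fraction field: then the primitive part of f is prime, and otherwise f
   splits into factors of smaller degree. *)
have [irr_f|nirr] := classic (Pdiv.Idomain.irreducible_poly f).
  have [s [f' [ps prim_f' e]]] := primitive_decomposition f0.
  have sC0 : \prod_(p <- s) p != 0.
    by rewrite prodf_seq_neq0; apply/allP => p /ps[].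
  exists 1, (f' :: [seq p%:P | p <- s]); split.
  - by exists 1; rewrite mulr1.
  - move=> q; rewrite inE => /predU1P[->|/mapP[p /ps pp ->]]; last exact: rprime_polyC.
    apply: rprime_primitive_irreducible => //.
    have e2 : Pdiv.Idomain.eqp f' f by rewrite e mul_polyC Pdiv.Idomain.eqp_sym Pdiv.Idomain.eqp_scale.
    split; first by rewrite (Pdiv.Idomain.eqp_size e2).
    move=> q' q'1; rewrite (Pdiv.Idomain.eqp_dvdr _ e2) (Pdiv.Idomain.eqp_rtrans e2).
    by case: irr_f => _; apply.
  - by rewrite mul1r big_cons big_map -rmorph_prod /= mulrC -e.
have [q [q1 qf nqf]] : exists q : {poly A}, [/\ size q != 1%N, Pdiv.Idomain.dvdp q f & ~~ Pdiv.Idomain.eqp q f].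
  apply: NNPP => h; apply: nirr; split=> // q q1 qf; apply/negPn/negP => nqf.
  by apply: h; exists q.
have [[a k] /= a0 e] := Pdiv.Idomain.dvdpP _ _ qf.
have [k' [q' [sk sq ef]]] := factorial_scale_split a0 e.
have [k'0 q'0] : k' != 0 /\ q' != 0 by move: f0; rewrite ef mulf_eq0 negb_or => /andP.
have lt_qf : (size q < size f)%N.
  by rewrite ltn_neqAle Pdiv.Idomain.dvdp_leq // andbT Pdiv.Idomain.dvdp_size_eqp.
have szf : size f = (size k' + size q').-1 by rewrite {1}ef size_mul.
have [|u [s [u1 ps ek]]] := IH k' _ k'0.
  move: szf le_m q1 k'0 q'0; rewrite -!size_poly_gt0 -sq; move: (size k') (size q') (size f) => x y z; lia.
have [|v [t [v1 pt eq]]] := IH q' _ q'0.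
  by rewrite sq; apply: leq_trans lt_qf _.
exists (u * v), (s ++ t); split.
- by case: u1 v1 => [x ux] [y vy]; exists (x * y); rewrite -[1]mulr1 {1}ux vy; ring.
- by move=> p; rewrite mem_cat => /orP[/ps|/pt].
- by rewrite ef ek eq big_cat /=; ring.
Qed.

End Factorial.

Lemma rprime_iso (A B : idomainType) (phi : {rmorphism A -> B})
    (psi : {rmorphism B -> A}) (p : A) :
  cancel phi psi -> cancel psi phi -> rprime p -> rprime (phi p).
Proof.
move=> phiK psiK [p0 p1 pM].
have dvd x : rdvd (phi p) x -> rdvd p (psi x).
  by case=> k ->; exists (psi k); rewrite rmorphM phiK.
have dvd' x : rdvd p (psi x) -> rdvd (phi p) x.
  by case=> k e; exists (phi k); rewrite -rmorphM -e psiK.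
split.
- by rewrite -(rmorph0 phi) (can_eq phiK).
- by move/dvd; rewrite rmorph1.
- by move=> x y /dvd; rewrite rmorphM => /pM[/dvd'|/dvd']; [left|right].
Qed.

Lemma factorial_iso (A B : idomainType) (phi : {rmorphism A -> B})
    (psi : {rmorphism B -> A}) :
  cancel phi psi -> cancel psi phi -> factorial A -> factorial B.
Proof.
move=> phiK psiK factA b b0.
have pb0 : psi b != 0 by rewrite -(rmorph0 psi) (can_eq psiK).
have [u [s [[v uv] ps e]]] := factA _ pb0.
exists (phi u), (map phi s); split.
- by exists (phi v); rewrite -rmorphM -uv rmorph1.
- by move=> _ /mapP[p /ps pp ->]; apply: rprime_iso pp.
- by rewrite big_map -rmorph_prod -rmorphM -e psiK.
Qed.

(** * Polynomials in n+1 variables as univariate polynomials along a direction *)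

Section Slice.
Variables (R : comNzRingType) (n : nat) (e : 'I_n -> R).
Local Notation w := (widen_ord (leqnSn n)).

(* Coordinates on R^(n+1) in which the lines of direction (e, 1) are the fibres
   of the projection to the first n coordinates. *)
Definition slice_var (i : 'I_n.+1) : {poly {mpoly R[n]}} :=
  if unlift ord_max i is Some j then ('X_j)%:P + ((e j)%:MP)%:P * 'X else 'X.

Definition slice : {mpoly R[n.+1]} -> {poly {mpoly R[n]}} :=
  mmap (polyC \o @mpolyC n R) slice_var.

HB.instance Definition _ := GRing.RMorphism.on slice.

(** Linear forms that are constant along (e, 1). *)
Definition unslice_tuple : n.-tuple {mpoly R[n.+1]} :=
  [tuple 'X_(lift ord_max j) - (e j)%:MP * 'X_ord_max | j < n].

Definition unslice : {poly {mpoly R[n]}} -> {mpoly R[n.+1]} :=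
  horner_eval 'X_ord_max \o map_poly (comp_mpoly unslice_tuple).

HB.instance Definition _ := GRing.RMorphism.on unslice.

Lemma sliceD : {morph slice : p q / p + q}. Proof. exact: rmorphD. Qed.
Lemma sliceM : {morph slice : p q / p * q}. Proof. exact: rmorphM. Qed.
Lemma unsliceD : {morph unslice : p q / p + q}. Proof. exact: rmorphD. Qed.
Lemma unsliceM : {morph unslice : p q / p * q}. Proof. exact: rmorphM. Qed.

Lemma unsliceC r : unslice r%:P = r \mPo unslice_tuple.
Proof. by rewrite /unslice /= map_polyC /= horner_evalE hornerC. Qed.

Lemma unsliceX : unslice 'X = 'X_ord_max.
Proof. by rewrite /unslice /= map_polyX horner_evalE hornerX. Qed.

Lemma sliceC c : slice c%:MP = (c%:MP)%:P.
Proof. exact: mmapC. Qed.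

Lemma sliceX i : slice 'X_i = slice_var i.
Proof. by rewrite /slice mmapX mmap1U. Qed.

Lemma sliceK : cancel slice unslice.
Proof.
elim/mpoly_ring_ind => [c|i|p q hp hq|p q hp hq].
- by rewrite sliceC unsliceC comp_mpolyC.
- rewrite sliceX /slice_var; case: unliftP => [j|] ->; last exact: unsliceX.
  rewrite unsliceD unsliceM !unsliceC unsliceX comp_mpolyC comp_mpolyXU -tnth_nth.
  by rewrite tnth_mktuple subrK.
- rewrite sliceD unsliceD; exact: congr2 hp hq.
- rewrite sliceM unsliceM; exact: congr2 hp hq.
Qed.

Lemma unsliceK : cancel unslice slice.
Proof.
have sX : slice 'X_ord_max = 'X by rewrite sliceX /slice_var unlift_none.
have sC r : slice (unslice r%:P) = r%:P.
  elim/mpoly_ring_ind: r => [c|j|p q hp hq|p q hp hq].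
  - by rewrite unsliceC comp_mpolyC sliceC.
  - rewrite unsliceC comp_mpolyXU -tnth_nth tnth_mktuple rmorphB rmorphM /= sX sliceC.
    by rewrite sliceX /slice_var liftK addrK.
  - rewrite polyCD unsliceD sliceD; exact: congr2 hp hq.
  - rewrite polyCM unsliceM sliceM; exact: congr2 hp hq.
elim/poly_ind => [|p r IH]; first by rewrite !rmorph0.
rewrite unsliceD unsliceM sliceD sliceM unsliceX sX sC.
by congr (_ * _ + _).
Qed.

End Slice.

Lemma factorial_mpoly (K : fieldType) (n : nat) : factorial {mpoly K[n]}.
Proof.
elim: n => [|n IH].
  move=> a a0; exists a, [::]; split=> //; last by rewrite big_nil mulr1.
  have ea := nvar0_mpolyC a; exists ((a@_0%MM)^-1)%:MP.
  rewrite {2}ea -mpolyCM mulVf ?mpolyC1 //.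
  by move: a0; rewrite {1}ea mpolyC_eq0.
(* For e = 0 this is the usual isomorphism of K[x_1, ..., x_(n+1)] with K[x_1, ..., x_n][X]. *)
pose phi := [the {rmorphism _ -> _} of unslice (fun _ : 'I_n => 0 : K)].
pose psi := [the {rmorphism _ -> _} of slice (fun _ : 'I_n => 0 : K)].
apply: (@factorial_iso _ _ phi psi).
- exact: unsliceK.
- exact: sliceK.
- exact: factorial_poly.
Qed.

(** * Polynomials that are rational functions of F *)

Lemma poly_neq0_point (K : fieldType) (q : {poly K}) :
  [pchar K] =i pred0 -> q != 0 -> exists t, q.[t] != 0.
Proof.
move=> ch q0; apply: NNPP => h.
suff : (size q < size q)%N by rewrite ltnn.
rewrite -{1}(size_iota 0 (size q)) -(size_map (fun m : nat => m%:R : K)).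
apply: max_poly_roots => //.
  by apply/allP => _ /mapP[m _ ->]; apply: contra_notT h => nr; exists m%:R.
rewrite map_inj_uniq ?iota_uniq // => i j.
wlog le_ij : i j / (i <= j)%N => [hw|].
  by case: (leqP i j) => [/hw//|/ltnW/hw h' e]; apply/esym/h'.
move/eqP; rewrite eq_sym -subr_eq0 -natrB //.
case e: (j - i)%N => [|k]; last by rewrite (negbTE (pchar0_natr ch k)).
by move=> _; apply/eqP; rewrite eqn_leq le_ij -subn_eq0 e.
Qed.

Lemma mpoly_neq0_point (K : fieldType) (n : nat) (q : {mpoly K[n]}) :
  [pchar K] =i pred0 -> q != 0 -> exists v, q.@[v] != 0.
Proof.
move=> ch; elim: n q => [|n IH] q q0.
  exists (fun _ => 0); have eq := nvar0_mpolyC q; rewrite eq mevalC.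
  by move: q0; rewrite {1}eq mpolyC_eq0.
pose e0 := fun _ : 'I_n => 0 : K.
have sq0 : slice e0 q != 0.
  by apply: contraNneq q0 => sq0; rewrite -(sliceK e0 q) sq0 rmorph0.
have lc0 : lead_coef (slice e0 q) != 0 by rewrite lead_coef_eq0.
(* At such a w the leading coefficient in the last variable survives, so the specialized univariate
   polynomial is nonzero. *)
have [w lcw] := IH _ lc0.
have Q0 : map_poly (meval w) (slice e0 q) != 0 by rewrite map_poly_eq0_id0.
have [t Qt] := poly_neq0_point ch Q0.
pose v i := if unlift ord_max i is Some j then w j else t.
exists v; suff -> : q.@[v] = (map_poly (meval w) (slice e0 q)).[t] by [].
elim/mpoly_ring_ind: (q) => [c|i|p1 p2 h1 h2|p1 p2 h1 h2].
- by rewrite sliceC map_polyC hornerC /= !mevalC.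
- rewrite sliceX mevalXU /slice_var /v; case: unlift => [j|]; last by rewrite map_polyX hornerX.
  by rewrite mpolyC0 mul0r addr0 map_polyC hornerC /= mevalXU.
- by rewrite mevalD h1 h2 sliceD rmorphD hornerD.
- by rewrite mevalM h1 h2 sliceM rmorphM hornerM.
Qed.

(** * Directional derivatives and restriction to lines *)

Definition dirderiv (K : fieldType) (n : nat) (e : 'I_n -> K) (q : {mpoly K[n]}) :=
  \sum_i e i *: q^`M(i).

Section Line.
Variables (K : fieldType) (n : nat) (y e : 'I_n -> K).
Hypothesis charK0 : [pchar K] =i pred0.
Implicit Types (p q : {mpoly K[n]}).

Definition line : {mpoly K[n]} -> {poly K} :=
  mmap polyC (fun i => (y i)%:P + (e i)%:P * 'X).

HB.instance Definition _ := GRing.RMorphism.on line.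

Lemma lineC c : line c%:MP = c%:P.
Proof. exact: mmapC. Qed.

Lemma lineX i : line 'X_i = (y i)%:P + (e i)%:P * 'X.
Proof. by rewrite /line mmapX mmap1U. Qed.

Lemma horner_line q t : (line q).[t] = q.@[fun i => y i + e i * t].
Proof.
elim/mpoly_ring_ind: q => [c|i|p q hp hq|p q hp hq].
- by rewrite lineC hornerC mevalC.
- by rewrite lineX mevalXU !hornerE.
- by rewrite !rmorphD /= hornerD hp hq.
- by rewrite !rmorphM /= hornerM hp hq.
Qed.

Lemma deriv_line q : (line q)^`() = line (dirderiv e q).
Proof.
rewrite /dirderiv; elim/mpoly_ring_ind: q => [c|i|p q hp hq|p q hp hq].
- by rewrite lineC derivC big1 ?rmorph0 // => i _; rewrite mderivC scaler0.
- rewrite lineX derivD derivC add0r mul_polyC derivZ derivX (bigD1 i) //= big1.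
    by rewrite mderivXU eqxx addr0 -mul_mpolyC mulr1 lineC -mul_polyC mulr1.
  by move=> j ji; rewrite mderivXU eq_sym (negbTE ji) scaler0.
- rewrite rmorphD /= derivD hp hq -rmorphD -big_split; congr (line _).
  by apply: eq_bigr => i _; rewrite mderivD scalerDr.
- rewrite rmorphM /= derivM hp hq -!rmorphM -rmorphD; congr (line _) => /=.
  rewrite mulr_suml mulr_sumr -big_split; apply: eq_bigr => i _ /=.
  by rewrite mderivM -!mul_mpolyC; ring.
Qed.

Lemma meval_iter_dirderiv q k :
  (iter k (dirderiv e) q).@[y] = (line q)`_k *+ k`!.
Proof.
have -> : (line q)`_k *+ k`! = ((line q)^`(k)).[0].
  by rewrite horner_coef0 coef_derivn addn0 ffactnn.
elim: k q => [|k IH] q.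
  by rewrite /= horner_line; apply: meval_eq => i; rewrite mulr0 addr0.
by rewrite iterSr IH derivSn deriv_line.
Qed.

(** Otherwise all Taylor coefficients of q along the line would vanish, as k! is invertible in
    characteristic zero. *)
Lemma exists_iter_dirderiv_neq0 q t : q.@[fun i => y i + e i * t] != 0 ->
  exists k, (iter k (dirderiv e) q).@[y] != 0.
Proof.
rewrite -horner_line => qt; apply: NNPP => h; case/eqP: qt.
suff -> : line q = 0 by rewrite horner0.
apply/polyP => k; rewrite coef0; apply/eqP; apply: contra_notT h => qk; exists k.
rewrite meval_iter_dirderiv -mulr_natr mulf_neq0 //.
by case: (k`!) (fact_gt0 k) => // m _; apply: pchar0_natr.
Qed.

End Line.

(** If p(w) <> p(0), the restriction of p to the line through 0 and w is a nonconstant univariate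
    polynomial, so it has a root. *)
Lemma nonvanishing_mpoly_const (K : closedFieldType) (n : nat) (p : {mpoly K[n]}) :
  [pchar K] =i pred0 -> (forall v, p.@[v] != 0) -> exists c, p = c%:MP.
Proof.
move=> ch pv; pose k := p.@[fun _ => 0]; exists k; apply: NNPP => pk.
have pk0 : p - k%:MP != 0 by rewrite subr_eq0; apply/eqP.
have [w] := mpoly_neq0_point ch pk0; rewrite mevalB mevalC subr_eq0 => pw.
pose Q := line (fun _ => 0) w p.
have [t] : exists t, root Q t.
  apply/closed_rootP; apply: contra pw => /size_poly1P[c _ Qc].
  have Q0 : Q.[0] = k.
    by rewrite horner_line; apply: meval_eq => i; rewrite mulr0 addr0.
  have Q1 : Q.[1] = p.@[w].
    by rewrite horner_line; apply: meval_eq => i; rewrite mulr1 add0r.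
  by rewrite -Q1 -Q0 Qc !hornerC.
by rewrite rootE horner_line (negbTE (pv _)).
Qed.

(** r is the resultant, or a itself if a has degree 0. If the resultant vanished, p and a would have
    a nonconstant gcd over the fraction field; p prime would divide this gcd, hence a, or its
    cofactor in p, which makes the gcd constant. *)
Lemma rprime_resultant (A : idomainType) (p a : {poly A}) :
    rprime p -> (1 < size p)%N -> ~ rdvd p a ->
  exists2 r, r != 0 & exists s t, r%:P = s * a + t * p.
Proof.
move=> pp p_gt1 npa.
have npC c : c != 0 -> ~ rdvd p c%:P.
  move=> c0 [k /(congr1 (fun q : {poly A} => size q)) /=].
  have [->|k0] := eqVneq k 0; first by rewrite mul0r size_poly0 size_polyC c0.
  rewrite size_polyC c0 size_mul //; last by case: pp.
  by move: k0 p_gt1; rewrite -size_poly_gt0; move: (size k) (size p) => x y; lia.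
have [a_gt1|a_le1] := ltnP 1 (size a); last first.
  exists a`_0; last by exists 1, 0; rewrite mul1r mul0r addr0 -size1_polyC.
  apply/eqP => a0; apply: npa; exists 0.
  by rewrite mul0r (size1_polyC a_le1) a0 polyC0.
have [[s t] /= _ e] := resultant_in_ideal p_gt1 a_gt1.
exists (resultant p a); last by exists t, s; rewrite e addrC.
rewrite resultant_eq0 -leqNgt; set g := Pdiv.Idomain.gcdp p a.
have /Pdiv.Idomain.dvdpP[[c q] /= c0 ep] := Pdiv.Idomain.dvdp_gcdl p a.
have /Pdiv.Idomain.dvdpP[[d k] /= d0 ea] := Pdiv.Idomain.dvdp_gcdr p a.
rewrite -/g in ep ea.
have : rdvd p (q * g) by rewrite -ep; exists c%:P; rewrite mul_polyC.
case/(rprime_mul pp) => [[q' eq]|[g' eg]].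
  have p0 : p != 0 by case: pp.
  have ec : c%:P = q' * g.
    by apply: (mulIf p0); rewrite mul_polyC ep eq mulrAC.
  have c1 : size (q' * g) = 1%N by rewrite -ec size_polyC c0.
  have [q'0 g0] : q' != 0 /\ g != 0.
    by apply/andP; rewrite -negb_or -mulf_eq0 -size_poly_eq0 c1.
  rewrite size_mul // in c1; rewrite -!size_poly_gt0 in q'0 g0.
  by move: c1 q'0 g0; move: (size q') (size g) => x y; lia.
case: (npa); have : rdvd p (d%:P * a) by rewrite mul_polyC ea eg; exists (k * g'); rewrite mulrA.
by case/(rprime_mul pp) => // /(npC _ d0).
Qed.

Lemma exists_least (P : nat -> Prop) :
  (exists k, P k) -> exists2 k, P k & forall m, (m < k)%N -> ~ P m.
Proof.
case=> k; elim/ltn_ind: k => k IH Pk.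
case: (classic (exists2 m, (m < k)%N & P m)) => [[m /IH]|h]; first exact.
by exists k => // m lt_mk Pm; apply: h; exists m.
Qed.

Lemma derivation_iterM (R : comNzRingType) (D : R -> R) (N : nat) (x y : R) :
    {morph D : a b / a + b} -> (forall a b, D (a * b) = D a * b + a * D b) ->
  iter N D (x * y) = \sum_(k < N.+1) (iter k D x * iter (N - k) D y) *+ 'C(N, k).
Proof.
move=> DD DM; have D0 : D 0 = 0 by apply: (addIr (D 0)); rewrite -DD !add0r.
have DMn a k : D (a *+ k) = D a *+ k.
  by elim: k => [|k IH]; rewrite ?mulr0n // !mulrS DD IH.
elim: N => [|N IH]; first by rewrite big_ord_recl big_ord0 addr0.
rewrite iterS IH (big_morph D DD D0).
under eq_bigr => k _ do rewrite DMn DM mulrnDl.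
rewrite big_split /= addrC big_ord_recl [RHS]big_ord_recl /= !subn0 !bin0 -addrA; congr (_ + _).
under [RHS]eq_bigr => k _ do rewrite /bump /= add1n subSS binS mulrnDr.
rewrite [RHS]big_split /=; congr (_ + _).
rewrite [RHS]big_ord_recr /= bin_small // mulr0n addr0.
by apply: eq_bigr => k _; rewrite /bump /= add1n -(subnSK (ltn_ord k)).
Qed.

(** * Divisibility by p(F), and the intersection of K[x] with K(F) *)

Section Hartogs.
Variables (K : closedFieldType) (n : nat) (F : n.+1.-tuple {mpoly K[n.+1]}) (c : K).
Hypotheses (charK0 : [pchar K] =i pred0) (c_neq0 : c != 0)
  (detJ : \det (jacobian F) = c%:MP).

Local Notation d := (mnambu F c).
Local Notation word := (mnambu_word F c).

Definition dirnambu (e : 'I_n.+1 -> K) (f : {mpoly K[n.+1]}) :=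
  \sum_i e i *: d i f.

Lemma dirnambuD e : {morph dirnambu e : f g / f + g}.
Proof.
by move=> f g; rewrite -big_split; apply: eq_bigr => i _; rewrite mnambuD scalerDr.
Qed.

Lemma dirnambuM e f g :
  dirnambu e (f * g) = dirnambu e f * g + f * dirnambu e g.
Proof.
rewrite mulr_suml mulr_sumr -big_split; apply: eq_bigr => i _ /=.
by rewrite mnambuM -!mul_mpolyC; ring.
Qed.

Lemma iter_dirnambuD e N f g : iter N (dirnambu e) (f + g) =
  iter N (dirnambu e) f + iter N (dirnambu e) g.
Proof. by elim: N => //= N ->; rewrite dirnambuD. Qed.

Lemma dirnambu_comp e p : dirnambu e (p \mPo F) = dirderiv e p \mPo F.
Proof.
rewrite raddf_sum; apply: eq_bigr => i _ /=.
by rewrite comp_mpolyZ (mnambu_comp c_neq0 detJ).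
Qed.

Lemma iter_dirnambu_comp e k p :
  iter k (dirnambu e) (p \mPo F) = iter k (dirderiv e) p \mPo F.
Proof. by elim: k => //= k ->; rewrite dirnambu_comp. Qed.

Lemma dirderiv_mderiv e i (p : {mpoly K[n.+1]}) :
  dirderiv e p = 0 -> dirderiv e p^`M(i) = 0.
Proof.
move=> h; rewrite -[RHS](mderiv0 K i) -h raddf_sum; apply: eq_bigr => j _.
by rewrite [RHS]mderivZ mderiv_comm.
Qed.

Lemma dirnambu_word_comp e w p :
  dirderiv e p = 0 -> dirnambu e (word w (p \mPo F)) = 0.
Proof.
elim/last_ind: w p => [|w i IH] p h; first by rewrite dirnambu_comp h comp_mpoly0.
rewrite mnambu_word_rcons (mnambu_comp c_neq0 detJ).
exact/IH/dirderiv_mderiv.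
Qed.

Section Point.
Variables (v : 'I_n.+1 -> K) (e : 'I_n.+1 -> K).

(* f vanishes to infinite order at v along the direction e of the F-coordinates. *)
Definition flat (f : {mpoly K[n.+1]}) := forall N, (iter N (dirnambu e) f).@[v] = 0.

Lemma flatD f g : flat f -> flat g -> flat (f + g).
Proof. by move=> hf hg N; rewrite iter_dirnambuD mevalD hf hg addr0. Qed.

Lemma flatM f g : flat g -> flat (f * g).
Proof.
move=> hg N; rewrite (derivation_iterM _ _ _ (dirnambuD e) (dirnambuM e)).
rewrite raddf_sum big1 // => k _ /=.
by rewrite mevalMn mevalM hg mulr0 mul0rn.
Qed.

(** Every other Leibniz term contains a shorter word applied to g, which is flat, and flat functions
    are stable under sums and multiples. *)
Lemma flat_word_leibniz w f g :
    (forall w', (size w' < size w)%N -> flat (word w' g)) ->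
  flat (word w (f * g) - f * word w g).
Proof.
have [m] := ubnP (size w); elim: m w f g => // m IH w f g.
case/lastP: w => [_ _|w i]; first by rewrite subrr => N; elim: N => [|N IHN];
  [rewrite /= meval0 | rewrite iterSr (_ : dirnambu e 0 = 0) //;
   apply: big1 => j _; rewrite mnambu0 scaler0].
rewrite size_rcons ltnS => le_wm flat_w; rewrite !mnambu_word_rcons mnambuM mnambu_wordD.
rewrite -addrA; apply: flatD; last first.
  apply: IH => // w' lt_w'; rewrite -mnambu_word_rcons; apply: flat_w.
  by rewrite size_rcons ltnS.
rewrite -[word w _](subrK (d i f * word w g)); apply: flatD.
  by apply: IH => // w' lt_w'; apply/flat_w/ltnW.
by apply: flatM; apply: flat_w.
Qed.

(* Leibniz on a word w of minimal length with word w g not flat: the first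
   nonvanishing e-derivatives of p(F) and of word w g at v would multiply to a
   nonzero e-derivative of word w (r(F)), of positive order. *)
Lemma component_multiple_not_constant_along p r g : p.@[fun i => (tnth F i).@[v]] = 0 ->
    (exists k, (iter k (dirderiv e) p).@[fun i => (tnth F i).@[v]] != 0) ->
    r != 0 -> dirderiv e r = 0 ->
  (p \mPo F) * g <> r \mPo F.
Proof.
move=> pv /exists_least[i pi min_i] r0 er pgr.
have g0 : g != 0.
  apply: contraNneq r0 => g0; apply/eqP/(comp_mpoly_component_eq0 charK0 c_neq0 detJ).
  by rewrite -pgr g0 mulr0.
have : exists k, exists2 w, size w = k & ~ flat (word w g).
  apply: NNPP => h; case/eqP: g0.
  apply: (mnambu_word_ext charK0 c_neq0 detJ (v := v)) => w.
  apply: NNPP => wg; apply: h; exists (size w), w => // /(_ 0%N).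
  exact: wg.
case/exists_least => k [w sw nflat] min_w.
have flat_w w' : (size w' < size w)%N -> flat (word w' g).
  by rewrite sw => /min_w h; apply: NNPP => nf; apply: h; exists w'.
have /exists_least[j gj min_j] : exists j, (iter j (dirnambu e) (word w g)).@[v] != 0.
  apply: NNPP => h; apply: nflat => j; apply: NNPP => gj.
  by apply: h; exists j; apply/eqP.
have i_gt0 : (0 < i)%N.
  by case: (i) pi => //; rewrite /= pv eqxx.
(* At order i + j the word of r(F) contributes nothing, as i > 0, and by minimality of i and j the
   Leibniz sum keeps only the term with i derivatives on p(F) and j on [word w g]. *)
have /(_ (i + j)%N) := flat_word_leibniz (p \mPo F) flat_w.
rewrite pgr -[- _]mulNr iter_dirnambuD mevalD.
have -> : iter (i + j) (dirnambu e) (word w (r \mPo F)) = 0.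
  have := dirnambu_word_comp w er; case: (i) i_gt0 => // i' _ h.
  have d0 : dirnambu e 0 = 0 by apply: big1 => t _; rewrite mnambu0 scaler0.
  by rewrite addSn iterSr h; elim: (i' + j)%N => //= N ->.
rewrite meval0 add0r (derivation_iterM _ _ _ (dirnambuD e) (dirnambuM e)).
have itN N f : iter N (dirnambu e) (- f) = - iter N (dirnambu e) f.
  elim: N => //= N ->; rewrite /dirnambu -sumrN; apply: eq_bigr => t _.
  by rewrite mnambuN scalerN.
have lt_ij : (i < (i + j).+1)%N by rewrite ltnS leq_addr.
rewrite raddf_sum (bigD1 (Ordinal lt_ij)) //= big1 => [|[l lt_l] /=]; last first.
  rewrite -val_eqE /= => li; rewrite mevalMn mevalM itN mevalN.
  have [lt_li|] := ltnP l i.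
    have /negP/negPn/eqP h : ~ ((iter l (dirnambu e) (p \mPo F)).@[v] != 0).
      by rewrite iter_dirnambu_comp comp_mpoly_meval; apply: min_i.
    by rewrite h oppr0 mul0r mul0rn.
  rewrite leq_eqVlt eq_sym (negbTE li) /= => lt_il.
  have /negP/negPn/eqP h : ~ ((iter (i + j - l) (dirnambu e) (word w g)).@[v] != 0).
    by apply: min_j; move: lt_l lt_il; lia.
  by rewrite h mulr0 mul0rn.
rewrite addr0 mevalMn mevalM itN mevalN addKn iter_dirnambu_comp comp_mpoly_meval.
move/eqP; rewrite mulNr mulNrn oppr_eq0 -mulr_natr mulf_eq0 mulf_eq0.
rewrite (negbTE pi) (negbTE gj) /=.
by case: 'C(_, _) (bin_gt0 (i + j) i) => [|b]; rewrite ?leq_addr // (negbTE (pchar0_natr _ _)).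
Qed.

End Point.

Lemma rprime_component_dvd p a f : rprime p -> (p \mPo F) * f = a \mPo F -> rdvd p a.
Proof.
move=> pp pf; apply: NNPP => npa.
have [p0 p1 _] := pp.
(* Without such a zero p(F), hence p, would be a nonzero constant, that is a unit. *)
have [v pv] : exists v, (p \mPo F).@[v] = 0.
  apply: NNPP => h.
  have [|k pk] := @nonvanishing_mpoly_const _ _ (p \mPo F) charK0.
    by move=> v; apply/eqP => pv; apply: h; exists v.
  have ep : p = k%:MP.
    by apply: (comp_mpoly_component_inj charK0 c_neq0 detJ); rewrite /= comp_mpolyC.
  apply: p1; exists (k^-1)%:MP; rewrite ep -mpolyCM mulVf ?mpolyC1 //.
  by move: p0; rewrite ep mpolyC_eq0.
rewrite comp_mpoly_meval in pv; set y := (fun i => _) in pv.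
(* The second factor makes z and y differ in the last coordinate, so that e can be normalized to
   last coordinate 1, as [slice] requires. *)
have q0 : p * ('X_ord_max - (y ord_max)%:MP) != 0.
  rewrite mulf_neq0 // subr_eq0; apply/eqP => /(congr1 (mcoeff U_(ord_max)%MM)).
  rewrite mcoeffX mcoeffC eqxx mnm1_eq0 mulr0 => /eqP.
  by rewrite oner_eq0.
have [z] := mpoly_neq0_point charK0 q0.
rewrite mevalM mevalB mevalXU mevalC mulf_eq0 negb_or => /andP[pz tz].
pose t := z ord_max - y ord_max; pose e i := (z i - y i) / t.
have e_max : e ord_max = 1 by rewrite /e divff.
have /(exists_iter_dirderiv_neq0 charK0) ek : p.@[fun i => y i + e i * t] != 0.
  suff -> : p.@[fun i => y i + e i * t] = p.@[z] by [].
  by apply: meval_eq => i; rewrite /e divfK // addrC subrK.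
pose e' j := e (lift ord_max j).
have er r : dirderiv e (unslice e' r%:P) = 0.
  rewrite unsliceC /dirderiv.
  under eq_bigr => i _ do rewrite mderiv_comp_mpoly scaler_sumr.
  rewrite exchange_big big1 // => j _ /=.
  under eq_bigr => i _ do rewrite scalerAr.
  rewrite -mulr_sumr; apply/eqP; rewrite mulf_eq0; apply/orP; right; apply/eqP.
  under eq_bigr => i _ do rewrite tnth_mktuple mderivB mderiv_mulC !mderivXU scalerBr.
  rewrite sumrB (bigD1 (lift ord_max j)) //= big1 ?addr0 => [|i ij]; last first.
    by rewrite eq_sym (negbTE ij) scaler0.
  rewrite (bigD1 ord_max) //= big1 ?addr0 => [|i im]; last first.
    by rewrite eq_sym (negbTE im) mulr0 scaler0.
  by rewrite !eqxx e_max scale1r mulr1 -mul_mpolyC mulr1 subrr.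
pose phi := [the {rmorphism _ -> _} of slice e'].
pose psi := [the {rmorphism _ -> _} of unslice e'].
have pp' : rprime (slice e' p) by apply: (@rprime_iso _ _ phi psi) pp; [apply: sliceK | apply: unsliceK].
(* Were p constant along e, its e-derivatives of positive order would vanish; with p(y) = 0 this
   contradicts [ek]. *)
have p_gt1 : (1 < size (slice e' p))%N.
  rewrite ltnNge; apply/negP => /size1_polyC ep.
  case: ek => [[|k]]; first by rewrite /= pv eqxx.
  rewrite iterSr -(sliceK e' p) ep er.
  have d0 : dirderiv e 0 = 0 :> {mpoly K[n.+1]} by apply: big1 => i _; rewrite mderiv0 scaler0.
  by rewrite (_ : iter k _ 0 = 0) ?meval0 ?eqxx //; elim: k => //= k ->.
have npa' : ~ rdvd (slice e' p) (slice e' a).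
  case=> k ek'; apply: npa; exists (unslice e' k).
  by rewrite -(sliceK e' a) ek' unsliceM sliceK.
have [r r0 [s [u ru]]] := rprime_resultant pp' p_gt1 npa'.
have eru : unslice e' r%:P = unslice e' s * a + unslice e' u * p.
  rewrite ru; apply: etrans (unsliceD e' _ _) _.
  apply: congr2; apply: etrans (unsliceM e' _ _) _; apply: congr2 => //; exact: sliceK.
have r0' : unslice e' r%:P != 0.
  apply/eqP => /(congr1 phi) h; case/eqP: r0; apply: polyC_inj.
  exact: etrans (esym (unsliceK e' r%:P)) (etrans h (rmorph0 phi)).
(* Since a(F) = p(F) f, the relation r = s a + u p makes r(F) a multiple of p(F). *)
apply: (component_multiple_not_constant_along (g := (unslice e' s \mPo F) * f + (unslice e' u \mPo F)) pv ek r0' (er r)).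
rewrite eru; move: (unslice e' s) (unslice e' u) => s1 u1.
by rewrite comp_mpolyD !(rmorphM (comp_mpoly F)) /= -pf; ring.
Qed.

(** The primes of b are cancelled one by one, as each divides a by [rprime_component_dvd]. *)
Lemma component_quotient_polynomial a b f : b != 0 ->
  (b \mPo F) * f = a \mPo F -> exists g, f = g \mPo F.
Proof.
move=> b0; have [u [s [[w uw] ps ->]]] := factorial_mpoly b0.
elim: s a ps => [|p s IH] a ps.
  rewrite big_nil mulr1 => uf; exists (w * a).
  rewrite rmorphM /= -uf mulrA -rmorphM -uw /= (rmorph1 (comp_mpoly F)) mul1r //.
rewrite big_cons => e.
have pp : rprime p by apply: ps; rewrite mem_head.
have e' : (p \mPo F) * (((u * \prod_(q <- s) q) \mPo F) * f) = a \mPo F.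
  by rewrite -e !rmorphM /=; ring.
have [k ek] := rprime_component_dvd pp e'.
apply: (IH k) => [q qs|]; first by apply: ps; rewrite inE qs orbT.
have pF0 : p \mPo F != 0.
  case: pp => p0 _ _; apply: contraNneq p0.
  by move/(comp_mpoly_component_eq0 charK0 c_neq0 detJ) => ->.
by apply: (mulfI pF0); rewrite e' ek rmorphM mulrC.
Qed.

End Hartogs.

(** * Conjugates of the generic point *)

Lemma ratfun_lift (K : fieldType) (n : nat) (E : fieldType)
    (phi : {rmorphism {mpoly K[n]} -> E}) : injective phi ->
  exists io : {rmorphism ratfun K n -> E}, forall p, io p%:F = phi p.
Proof.
move=> inj_phi.
have phi0 q : q != 0 -> phi q != 0 by rewrite -(rmorph0 phi) (inj_eq inj_phi).
pose io (x : ratfun K n) := phi (\n_(repr x)) / phi (\d_(repr x)).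
have ioE p q : q != 0 -> io (p%:F / q%:F) = phi p / phi q.
  move=> q0; rewrite /io; set x : ratfun K n := p%:F / q%:F.
  have := frac_repr x; have := denom_ratioP (repr x).
  move: (\n_(repr x)) (\d_(repr x)) => a b b0; rewrite /x => /eqP.
  rewrite eqr_div ?tofrac_eq0 // -!tofracM tofrac_eq => /eqP e.
  by apply/eqP; rewrite eqr_div ?phi0 // -!rmorphM e.
have fracP x : exists p q, q != 0 /\ x = p%:F / q%:F :> ratfun K n.
  by exists (\n_(repr x)), (\d_(repr x)); split; [apply: denom_ratioP | apply: frac_repr].
have ioF p : io p%:F = phi p.
  by rewrite -[p%:F]divr1 -tofrac1 ioE ?oner_neq0 // rmorph1 divr1.
have ioB : zmod_morphism io.
  move=> x y; have [p [q [q0 ->]]] := fracP x; have [r [s [s0 ->]]] := fracP y.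
  rewrite -mulNr -tofracN addf_div ?tofrac_eq0 // -!tofracM -tofracD !ioE ?mulf_neq0 //.
  by rewrite -mulNr addf_div ?phi0 // rmorphD !rmorphM rmorphN.
have ioM : monoid_morphism io.
  split=> [|x y]; first by rewrite -tofrac1 ioF rmorph1.
  have [p [q [q0 ->]]] := fracP x; have [r [s [s0 ->]]] := fracP y.
  by rewrite mulf_div -!tofracM !ioE ?mulf_neq0 // mulf_div !rmorphM.
pose io' : {rmorphism ratfun K n -> E} := HB.pack io
  (GRing.isZmodMorphism.Build _ _ io ioB) (GRing.isMonoidMorphism.Build _ _ io ioM).
by exists io'.
Qed.

Lemma map_mpolyD (R S : comNzRingType) (f : {rmorphism R -> S}) (n : nat) :
  {morph @map_mpoly n R S f : p q / p + q}.
Proof. exact: rmorphD. Qed.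

Lemma map_mpolyM (R S : comNzRingType) (f : {rmorphism R -> S}) (n : nat) :
  {morph @map_mpoly n R S f : p q / p * q}.
Proof. exact: rmorphM. Qed.

(** * Extension of the base field *)

Section BaseChange.
Variables (K L : fieldType) (ka : {rmorphism K -> L}) (n : nat).

Lemma mderiv_map_mpoly i (p : {mpoly K[n]}) :
  (map_mpoly ka p)^`M(i) = map_mpoly ka p^`M(i).
Proof.
by apply/mpolyP => m; rewrite !(mcoeff_deriv, mcoeff_map_mpoly) raddfMn.
Qed.

Lemma map_comp_mpoly k (p : {mpoly K[n]}) (q : n.-tuple {mpoly K[k]}) :
  map_mpoly ka (p \mPo q) = map_mpoly ka p \mPo map_tuple (map_mpoly ka) q.
Proof.
elim/mpoly_ring_ind: p => [a|j|p1 p2 h1 h2|p1 p2 h1 h2].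
- by rewrite comp_mpolyC !map_mpolyC comp_mpolyC.
- by rewrite comp_mpolyXU map_mpolyX comp_mpolyXU -!tnth_nth tnth_map.
- by rewrite comp_mpolyD !map_mpolyD comp_mpolyD h1 h2.
- by rewrite comp_mpolyM !map_mpolyM comp_mpolyM h1 h2.
Qed.

Variables (F : n.-tuple {mpoly K[n]}) (c : K).
Local Notation FL := (map_tuple (map_mpoly ka) F).

Lemma map_jacobian : jacobian FL = map_mx (map_mpoly ka) (jacobian F).
Proof. by apply/matrixP => i j; rewrite !mxE tnth_map mderiv_map_mpoly. Qed.

Lemma map_mnambu i f :
  mnambu FL (ka c) i (map_mpoly ka f) = map_mpoly ka (mnambu F c i f).
Proof.
rewrite /mnambu (raddf_sum (map_mpoly ka)); apply: eq_bigr => j _.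
rewrite -!mul_mpolyC /= !map_mpolyM map_mpolyC mderiv_map_mpoly.
apply: congr2; first by apply: (congr1 (@mpolyC n L)); apply/esym/fmorphV.
by rewrite map_jacobian -map_mx_adj [map_mx _ _ j i]mxE.
Qed.

Lemma map_mwronskian i j k :
  mwronskian FL (ka c) i j k = map_mpoly ka (mwronskian F c i j k).
Proof.
rewrite /mwronskian -!mul_mpolyC map_mpolyM map_mpolyC.
apply: congr2; first by apply: (congr1 (@mpolyC n L)); apply/esym/fmorphV.
rewrite (raddf_sum (map_mpoly ka)).
apply: eq_bigr => t _; rewrite /= map_mpolyM tnth_map mderiv_map_mpoly.
by rewrite -!map_mnambu map_mpolyX.
Qed.

End BaseChange.

Lemma exists_irreducible_factor (E : fieldType) (nu : {poly E}) :
  (1 < size nu)%N -> exists2 pi, irreducible_poly pi & pi %| nu.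
Proof.
move=> nu_gt1; have [|k [pi pi_gt1 [pi_nu szk]] min_k] := @exists_least
    (fun k => exists2 pi : {poly E}, (1 < size pi)%N & pi %| nu /\ size pi = k).
  by exists (size nu), nu; rewrite ?dvdpp.
exists pi => //; split=> // q q1 q_pi; rewrite -dvdp_size_eqp //.
have pi0 : pi != 0 by rewrite -size_poly_gt0 ltnW.
rewrite eqn_leq dvdp_leq //= leqNgt; apply/negP => lt_q.
apply: (min_k (size q)); first by rewrite -szk.
exists q; last by split=> //; apply: dvdp_trans pi_nu.
rewrite ltn_neqAle eq_sym q1 size_poly_gt0; apply: contraTneq q_pi => ->.
by rewrite dvd0p.
Qed.

(* The conjugate z' is a root of the cofactor of 'X - z in the minimal polynomial
   of z; it differs from z because the minimal polynomial is separable. *)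
Lemma exists_conjugate (L E : fieldType) (io : {rmorphism L -> E}) (z : E) :
    [pchar L] =i pred0 -> (exists2 q, q != 0 & root (map_poly io q) z) ->
  (exists x, io x = z) \/
  exists (Om : fieldType) (om : {rmorphism E -> Om}) (z' : Om), z' != om z /\
    forall q, (map_poly io q).[z] = 0 -> (map_poly om (map_poly io q)).[z'] = 0.
Proof.
move=> charL0 [q0 q00 q0z].
have [|k [mu mu0 [mu_z szk]] min_k] := @exists_least (fun k =>
    exists2 mu : {poly L}, mu != 0 & root (map_poly io mu) z /\ size mu = k).
  by exists (size q0), q0.
have min_mu q : root (map_poly io q) z -> (size q < size mu)%N -> q = 0.
  move=> q_z lt_q; apply/eqP/negPn/negP => qn0.
  by apply: (min_k (size q)); rewrite -?szk //; exists q.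
have mu_dvd q : root (map_poly io q) z -> mu %| q.
  move=> q_z; apply/eqP/min_mu; last by rewrite ltn_modp.
  have e : q %% mu = q - q %/ mu * mu by rewrite {2}(divp_eq q mu) addrAC subrr add0r.
  rewrite rootE e rmorphB rmorphM hornerD hornerN hornerM.
  by rewrite (rootP q_z) (rootP mu_z) mulr0 subrr.
(* If the minimal polynomial is linear, z lies in the image of io. *)
have [mu_le2|mu_gt2] := leqP (size mu) 2.
  have [m0 [m1 emu]] : exists m0 m1, mu = m0%:P + m1%:P * 'X.
    exists mu`_0, mu`_1; apply/polyP => j; rewrite coefD coefC coefCM coefX.
    case: j => [|[|j]]; rewrite ?mulr0 ?addr0 ?mulr1 ?add0r //.
    by rewrite nth_default // (leq_trans mu_le2).
  have m1_neq0 : m1 != 0.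
    apply/eqP => m10; move: mu_z mu0; rewrite emu m10 mul0r addr0 map_polyC rootE.
    by rewrite hornerC fmorph_eq0 polyC_eq0 => ->.
  left; exists (- m0 / m1); move: mu_z.
  rewrite emu rootE rmorphD rmorphM /= map_polyX !map_polyC !hornerE.
  rewrite addr_eq0 => /eqP e; rewrite fmorph_div rmorphN e opprK mulrAC mulfV ?mul1r //.
  by rewrite fmorph_eq0.
right; have [nu enu] : exists nu, map_poly io mu = nu * ('X - z%:P).
  exact/factor_theorem.
(* nu(z) = mu'(z), and mu' is nonzero of smaller degree than the minimal polynomial. *)
have nu_z : nu.[z] != 0.
  have -> : nu.[z] = (map_poly io mu^`()).[z].
    rewrite -deriv_map enu derivM derivXsubC hornerD !hornerM hornerXsubC.
    by rewrite subrr mulr0 add0r hornerC mulr1.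
  apply/negP => /min_mu h'; have := h' (lt_size_deriv mu0).
  move/(congr1 (fun q : {poly _} => q`_(size mu).-2)); rewrite coef_deriv coef0.
  have -> : (size mu).-2.+1 = (size mu).-1 by case: (size mu) mu_gt2 => [|[|]].
  move/eqP; rewrite -mulr_natr mulf_eq0 -/(lead_coef mu) lead_coef_eq0 (negbTE mu0) /=.
  by case: (size mu) mu_gt2 => [|[|m]] // _; rewrite (negbTE (pchar0_natr charL0 _)).
have nu0 : nu != 0 by apply: contraNneq nu_z => ->; rewrite horner0.
have nu_gt1 : (1 < size nu)%N.
  have : size (map_poly io mu) = size mu by apply: size_map_poly.
  rewrite enu size_Mmonic ?monicXsubC // size_XsubC addn2 /= => e.
  by rewrite -ltnS e.
have [pi irr_pi pi_nu] := exists_irreducible_factor nu_gt1.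
have [Om _ [z' pi_z' _]] := irredp_FAdjoin irr_pi.
pose om : {rmorphism E -> Om} := [the {rmorphism _ -> _} of in_alg Om].
have nu_z' : (map_poly om nu).[z'] = 0.
  have /dvdpP[q ->] := pi_nu.
  by rewrite rmorphM hornerM [X in _ * X](rootP pi_z') mulr0.
exists Om, om, z'; split.
  apply: contraNneq nu_z => e; move: nu_z'; rewrite e horner_map => /eqP.
  by rewrite fmorph_eq0.
move=> q /rootP/mu_dvd/dvdpP [r ->].
by rewrite !rmorphM /= enu rmorphM /= !hornerM nu_z' mul0r mulr0.
Qed.

Section PrimitiveElement.
Variables (K : fieldType) (n : nat) (F : n.-tuple {mpoly K[n]}) (c : K).
Hypotheses (charK0 : [pchar K] =i pred0) (c_neq0 : c != 0)
  (detJ : \det (jacobian F) = c%:MP).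
Variables (h : {mpoly K[n]}) (a : 'I_n -> 'I_n -> 'I_n -> {mpoly K[n]}).
Hypotheses (h_neq0 : h != 0) (wronskian_rational :
  forall i j k, (h \mPo F) * mwronskian F c i j k = a i j k \mPo F).

(** The substitution x |-> F on K(x): its image is K(F), and [map_poly io q] is a polynomial with
    coefficients in K(F). *)
Variable io : {rmorphism ratfun K n -> ratfun K n}.
Hypothesis ioF : forall p, io p%:F = (p \mPo F)%:F.

Let charE0 : [pchar (ratfun K n)] =i pred0.
Proof.
have [ka _] : exists ka : {rmorphism K -> ratfun K n}, True.
  by exists [the {rmorphism _ -> _} of @FracField.tofrac {mpoly K[n]} \o @mpolyC n K].
by move=> p; rewrite (fmorph_pchar ka).
Qed.

Lemma algebraic_over_generated (l : {mpoly K[n]}) :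
  exists2 q, q != 0 & root (map_poly io q) l%:F.
Proof.
have [P P0 Pl] := algebraic_over_components F l.
exists (map_poly (@FracField.tofrac _) P).
  by rewrite map_poly_eq0_id0 // tofrac_eq0 lead_coef_eq0.
rewrite rootE -map_poly_comp -[X in _ == X]tofrac0 -Pl -horner_map -map_poly_comp.
by apply/eqP; congr (_.[_]); apply: eq_map_poly => p /=; rewrite ioF.
Qed.

Lemma primitive_element (s : seq {mpoly K[n]}) : exists th : {mpoly K[n]},
  forall f, f \in s -> exists q, (map_poly io q).[th%:F] = f%:F.
Proof.
elim: s => [|f s [th IH]]; first by exists 0.
have [p p0 pth] := algebraic_over_generated th.
have [q q0 qf] := algebraic_over_generated f.
(* For a suitable m, both th and f are polynomials in f m - th over K(F). *)
have [m [[r hr] [r' hr']]] := pchar0_PET p0 pth q0 qf charE0.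
exists (f *+ m - th) => g; rewrite tofracB tofracMn inE => /predU1P[->|/IH[u hu]].
  by exists r'.
by exists (u \Po r); rewrite map_comp_poly horner_comp hr.
Qed.

Lemma coordinate_in_generated t : exists x, io x = ('X_t)%:F.
Proof.
have [th gen_th] := primitive_element [seq 'X_t | t : 'I_n].
have {}gen_th s : exists q, (map_poly io q).[th%:F] = ('X_s)%:F.
  by apply: gen_th; apply/mapP; exists s; rewrite ?mem_enum.
have [[y hy]|[Om [om [th' [neq_th conj_th']]]]] :=
    exists_conjugate charE0 (algebraic_over_generated th).
  have [q hq] := gen_th t; exists q.[y].
  by rewrite -hq -hy horner_map.
exfalso.
(* q represents the element q(th) of K(x). By [ev0], q(th) |-> q(th') is well defined; it fixes K(F)
   and moves the generic point [v1] to [v2]. *)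
pose ev (q : {poly ratfun K n}) := (map_poly io q).[th%:F].
pose ev' (q : {poly ratfun K n}) := (map_poly om (map_poly io q)).[th'].
have ev0 q : ev q = 0 -> ev' q = 0 := @conj_th' q.
have [q_ hq] : exists q_ : 'I_n -> {poly ratfun K n}, forall s, ev (q_ s) = ('X_s)%:F.
  exact: (fin_all_exists gen_th).
pose ka : {rmorphism K -> Om} :=
  [the {rmorphism _ -> _} of om \o (@FracField.tofrac {mpoly K[n]} \o @mpolyC n K)].
pose v1 s := om ('X_s)%:F; pose v2 s := ev' (q_ s).
have v1E p : (map_mpoly ka p).@[v1] = om p%:F.
  elim/mpoly_ring_ind: p => [b|s|p1 p2 h1 h2|p1 p2 h1 h2].
  - by rewrite map_mpolyC mevalC.
  - by rewrite map_mpolyX mevalXU.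
  - by rewrite map_mpolyD mevalD h1 h2 tofracD (rmorphD om).
  - by rewrite map_mpolyM mevalM h1 h2 tofracM (rmorphM om).
have v2E p : exists2 q, ev q = p%:F & ev' q = (map_mpoly ka p).@[v2].
  elim/mpoly_ring_ind: p => [b|s|p1 p2 [q1 e1 e1'] [q2 e2 e2']|p1 p2 [q1 e1 e1'] [q2 e2 e2']].
  - exists ((b%:MP)%:F)%:P.
      by rewrite /ev map_polyC hornerC /= ioF comp_mpolyC.
    by rewrite /ev' !map_polyC hornerC /= ioF comp_mpolyC map_mpolyC mevalC.
  - by exists (q_ s); rewrite ?hq // map_mpolyX mevalXU.
  - exists (q1 + q2); first by rewrite /ev rmorphD hornerD tofracD -e1 -e2.
    by rewrite map_mpolyD mevalD -e1' -e2' /ev' !rmorphD hornerD.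
  - exists (q1 * q2); first by rewrite /ev rmorphM hornerM tofracM -e1 -e2.
    by rewrite map_mpolyM mevalM -e1' -e2' /ev' !rmorphM hornerM.
have ev'B q1 q2 : ev q1 = ev q2 -> ev' q1 = ev' q2.
  move=> e; apply/eqP; rewrite -subr_eq0; apply/eqP.
  have <- : ev' (q1 - q2) = ev' q1 - ev' q2 by rewrite /ev' !rmorphB hornerD hornerN.
  by apply: ev0; rewrite /ev rmorphB hornerD hornerN -/(ev q1) e subrr.
pose FL := map_tuple (map_mpoly ka) F.
have v12 : v1 =1 v2.
  apply: (@fiber_trivial Om n FL (ka c) _ _ _ v1 v2 (map_mpoly ka h) (fun i j k => map_mpoly ka (a i j k))).
  - by move=> p; rewrite (fmorph_pchar ka).
  - by rewrite fmorph_eq0.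
  - by rewrite map_jacobian det_map_mx detJ /= map_mpolyC.
  - move=> i j k; rewrite map_mwronskian -!map_comp_mpoly -wronskian_rational.
    by rewrite map_mpolyM.
  - move=> i; rewrite tnth_map v1E; have [q eq <-] := v2E (tnth F i).
    have -> : om (tnth F i)%:F = ev' (('X_i)%:F)%:P.
      by rewrite /ev' !map_polyC hornerC /= ioF comp_mpolyXU -tnth_nth.
    by apply: ev'B; rewrite eq /ev map_polyC hornerC /= ioF comp_mpolyXU -tnth_nth.
  (* h(F) is nonzero by algebraic independence, hence nonzero at the generic point. *)
  - rewrite -map_comp_mpoly v1E fmorph_eq0 tofrac_eq0; apply: contraNneq h_neq0.
    by move/(comp_mpoly_component_eq0 charK0 c_neq0 detJ) => ->.
(* th is a polynomial in x, so v1 = v2 forces th' = om th. *)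
case/eqP: neq_th; have [q eq eq'] := v2E th.
have -> : th' = ev' 'X by rewrite /ev' !map_polyX hornerX.
rewrite (@ev'B _ q); last by rewrite eq /ev map_polyX hornerX.
by rewrite eq' -v1E; apply: meval_eq => s; rewrite v12.
Qed.

End PrimitiveElement.

(** * The subfield generated by F *)

Lemma is_subfield_fractions (A : idomainType) (E : fieldType)
    (phi : {rmorphism A -> E}) : injective phi ->
  is_subfield (fun y => exists h a, h != 0 /\ phi h * y = phi a).
Proof.
move=> inj_phi.
have phi0 h : h != 0 -> phi h != 0 by rewrite -(rmorph0 phi) (inj_eq inj_phi).
split.
- by exists 1, 1; rewrite oner_neq0 mulr1.
- move=> y z [h [a [h0 ey]]] [k [b [k0 ez]]].
  exists (h * k), (a * k - h * b); rewrite mulf_neq0 //; split=> //.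
  by rewrite rmorphB !rmorphM -ey -ez; ring.
- move=> y z [h [a [h0 ey]]] [k [b [k0 ez]]].
  (* By convention y / 0 = 0. *)
  have [z0|z0] := eqVneq z 0.
    by exists 1, 0; rewrite oner_neq0 z0 invr0 !mulr0 rmorph0.
  have b0 : b != 0.
    apply: contraNneq z0 => b0; move/eqP: ez; rewrite b0 rmorph0 mulf_eq0.
    by rewrite (negbTE (phi0 _ k0)) /= => ->.
  exists (h * b), (a * k); rewrite mulf_neq0 //; split=> //.
  by rewrite !rmorphM -ey -ez; field.
Qed.

Section GeneratedField.
Variables (K : fieldType) (n : nat) (F : n.-tuple {mpoly K[n]}).

(** Minimality of K(F): fractions of polynomials in F form a subfield containing K and the F_i. *)
Lemma in_gen_subfield_fraction x : injective (comp_mpoly F) ->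
  in_gen_subfield F x ->
  exists h a : {mpoly K[n]}, h != 0 /\ (h \mPo F)%:F * x = (a \mPo F)%:F.
Proof.
move=> inj_F.
pose phi : {rmorphism {mpoly K[n]} -> ratfun K n} :=
  [the {rmorphism _ -> _} of @FracField.tofrac _ \o comp_mpoly F].
have inj_phi : injective phi.
  by move=> p q /eqP; rewrite /phi /= tofrac_eq => /eqP/inj_F.
move=> /(_ _ (is_subfield_fractions inj_phi)); apply.
- by move=> a; exists 1, a%:MP; rewrite oner_neq0 /= comp_mpoly1 comp_mpolyC tofrac1 mul1r.
- move=> i; exists 1, 'X_i; rewrite oner_neq0 /= comp_mpoly1 tofrac1 mul1r.
  by rewrite comp_mpolyXU -tnth_nth.
Qed.

Lemma is_subfield_gen : is_subfield (in_gen_subfield F).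
Proof.
split=> [S [S1 _ _] _ _ //|x y hx hy S hS hC hF|x y hx hy S hS hC hF].
- by case: (hS) => _ SB _; apply: SB; [apply: hx | apply: hy].
- by case: (hS) => _ _ SD; apply: SD; [apply: hx | apply: hy].
Qed.

Lemma in_gen_subfieldN x : in_gen_subfield F x -> in_gen_subfield F (- x).
Proof.
have [S1 SB _] := is_subfield_gen => hx.
have S0 : in_gen_subfield F 0 by rewrite -(subrr 1); apply: SB.
by rewrite -[- x]add0r; apply: SB.
Qed.

Lemma in_gen_subfield_sum (I : Type) (r : seq I) (P : pred I) (x : I -> ratfun K n) :
  (forall i, P i -> in_gen_subfield F (x i)) ->
  in_gen_subfield F (\sum_(i <- r | P i) x i).
Proof.
have [S1 SB _] := is_subfield_gen => hx; apply: big_ind => //.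
  by rewrite -(subrr 1); apply: SB.
move=> y z hy hz; rewrite -[z]opprK; apply: SB => //.
exact: in_gen_subfieldN.
Qed.

End GeneratedField.

(** p = (p o G) o F is a polynomial in F. *)
Lemma in_gen_subfield_polynomial (K : fieldType) (n : nat) (F G : n.-tuple {mpoly K[n]})
    (p : {mpoly K[n]}) :
  (forall i, tnth G i \mPo F = 'X_i) -> in_gen_subfield F p%:F.
Proof.
move=> GF S [S1 SB SD] SC SF.
have S0 : S 0 by rewrite -(subrr 1); apply: SB.
have SA x y : S x -> S y -> S (x + y).
  move=> Sx Sy; rewrite -[y]opprK; apply: (SB) => //.
  by rewrite -[- y]add0r; apply: SB.
have SM x y : S x -> S y -> S (x * y).
  move=> Sx Sy; rewrite -[y]invrK; apply: (SD) => //.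
  by rewrite -[y^-1]mul1r; apply: SD.
have Scomp q : S (q \mPo F)%:F.
  elim/mpoly_ring_ind: q => [a|i|p1 p2 h1 h2|p1 p2 h1 h2].
  - by rewrite comp_mpolyC; apply: SC.
  - by rewrite comp_mpolyXU -tnth_nth.
  - by rewrite comp_mpolyD tofracD; apply: SA.
  - by rewrite comp_mpolyM tofracM; apply: SM.
have <- : (p \mPo G) \mPo F = p; last exact: Scomp.
rewrite comp_mpolyA -[RHS]comp_mpoly_id; congr (_ \mPo _).
by apply: eq_from_tnth => i; rewrite !tnth_mktuple.
Qed.

(** * Polynomial maps and substitution *)

Lemma mpoly_meval_ext (K : fieldType) (n : nat) (p q : {mpoly K[n]}) :
  [pchar K] =i pred0 -> (forall v, p.@[v] = q.@[v]) -> p = q.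
Proof.
move=> ch pq; apply/eqP; rewrite -subr_eq0; apply/negPn/negP.
by move/(mpoly_neq0_point ch) => [v]; rewrite mevalB pq subrr eqxx.
Qed.

Lemma polymap_comp (K : fieldType) (n : nat) (F G : n.-tuple {mpoly K[n]}) (v : 'rV[K]_n) i :
  polymap G (polymap F v) 0 i = (tnth G i \mPo F).@[fun j => v 0 j].
Proof. by rewrite mxE comp_mpoly_meval; apply: meval_eq => j; rewrite mxE. Qed.

Lemma cancel_polymap (K : fieldType) (n : nat) (F G : n.-tuple {mpoly K[n]}) :
  (forall i, tnth G i \mPo F = 'X_i) -> cancel (polymap F) (polymap G).
Proof. by move=> GF v; apply/rowP => i; rewrite polymap_comp GF mevalXU. Qed.

Lemma cancel_polymap_comp (K : fieldType) (n : nat) (F G : n.-tuple {mpoly K[n]}) i :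
  [pchar K] =i pred0 -> cancel (polymap F) (polymap G) -> tnth G i \mPo F = 'X_i.
Proof.
move=> ch GF; apply: mpoly_meval_ext => // v.
have <- : polymap G (polymap F (\row_j v j)) 0 i = ('X_i).@[v].
  by rewrite GF mxE mevalXU.
by rewrite polymap_comp; apply: meval_eq => j; rewrite mxE.
Qed.

Lemma card_wronskian_indices (n : nat) :
  #|[set t : 'I_n * 'I_n * 'I_n |
      let: (i, j, k) := t in (i <= k)%N && ((i, j) != (k, k))]|
  = ((n ^ 2 * n.+1)./2 - n)%N.
Proof.
(* n^2 (n + 1) / 2 triples have i <= k, and the n diagonal ones are removed. *)
pose A := [set t : 'I_n * 'I_n * 'I_n | (t.1.1 <= t.2)%N].
pose D := [set (i, i, i) | i : 'I_n].
have -> : [set t : 'I_n * 'I_n * 'I_n |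
    let: (i, j, k) := t in (i <= k)%N && ((i, j) != (k, k))] = A :\: D.
  apply/setP => -[[i j] k]; rewrite !inE /= andbC; congr (~~ _ && _).
  apply/eqP/imsetP => [[-> ->]|[l _ [-> -> ->]]] //.
  by exists k.
have DA : D \subset A by apply/subsetP => _ /imsetP[i _ ->]; rewrite inE /=.
rewrite cardsD (setIidPr DA) card_imset => [|i j [] //]; rewrite card_ord.
congr (_ - _)%N.
have -> : #|A| = (n * \sum_(k < n) k.+1)%N.
  have count_le m k : (\sum_(i < m) (i <= k) = minn m k.+1)%N.
    by elim: m => [|m IH]; rewrite ?big_ord0 ?min0n // big_ord_recr /= IH; lia.
  transitivity (\sum_(i < n) \sum_(j < n) \sum_(k < n) (i <= k))%N.
    rewrite (pair_bigA _ (fun i j : 'I_n => \sum_(k < n) (i <= k))%N) /=.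
    rewrite (pair_bigA _ (fun (p : 'I_n * 'I_n) (k : 'I_n) => (p.1 <= k : nat)%N)) /=.
    rewrite -sum1_card big_mkcond /=; apply: eq_bigr => t _.
    by rewrite inE; case: (_ <= _)%N.
  rewrite exchange_big /= sum_nat_const card_ord exchange_big /=; congr (_ * _)%N.
  apply: eq_bigr => k _; rewrite count_le; apply/minn_idPr; exact: ltn_ord.
have -> : (\sum_(k < n) k.+1 = (n * n.+1)./2)%N.
  elim: n {A D DA} => [|n IH]; first by rewrite big_ord0.
  by rewrite big_ord_recr /= IH; lia.
have [m em] : exists m, (n * n.+1 = m.*2)%N.
  by exists (n * n.+1)./2; rewrite halfK oddM oddS andbN subn0.
by rewrite -mulnn -mulnA em -doubleMr !doubleK.
Qed.

Theorem mainTheorem1 (K : closedFieldType) (charK0 : [pchar K] =i pred0)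
    (n : nat) (n_gt0 : (0 < n)%N) (F : n.-tuple {mpoly K[n]})
    (c : K) (c_neq0 : c != 0) (detJ : \det (jacobian F) = c%:MP) :
  [/\ forall i j k : 'I_n,
        exists p : {mpoly K[n]}, gen_wronskian F i j k = p%:F,
      is_poly_automorphism F <->
        (forall i j k : 'I_n, (i <= k)%N -> (i, j) != (k, k) ->
           in_gen_subfield F (gen_wronskian F i j k))
    & #|[set t : 'I_n * 'I_n * 'I_n |
          let: (i, j, k) := t in (i <= k)%N && ((i, j) != (k, k))]|
      = ((n ^ 2 * n.+1)./2 - n)%N].
Proof.
case: n n_gt0 F detJ => // n _ F detJ.
have inj_F : injective (comp_mpoly F) := comp_mpoly_component_inj charK0 c_neq0 detJ.
have wE := gen_wronskianE c_neq0 detJ.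
split; [|split|exact: card_wronskian_indices].
- by move=> i j k; exists (mwronskian F c i j k).
- move=> [G [GF _]] i j k _ _; rewrite wE.
  by apply: (in_gen_subfield_polynomial (G := G)) => s; apply: cancel_polymap_comp.
move=> w_in.
have w_offdiag i j k : (i, j) != (k, k) -> in_gen_subfield F (gen_wronskian F i j k).
  move=> ne; case: (leqP i k) => [le_ik|lt_ki]; first exact: w_in.
  rewrite wE mwronskianC // -wE; apply: w_in; first exact: ltnW.
  by apply/eqP => -[ki _]; rewrite ki ltnn in lt_ki.
have w_all i j k : in_gen_subfield F (gen_wronskian F i j k).
  have [[-> ->]|] := eqVneq (i, j) (k, k); last exact: w_offdiag.
  have -> : gen_wronskian F k k k = - \sum_(s | s != k) gen_wronskian F s s k.
    have e : \sum_s gen_wronskian F s s k = 0.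
      under eq_bigr do rewrite wE.
      by rewrite -(rmorph_sum (@FracField.tofrac _)) (mwronskian_trace c_neq0 detJ) rmorph0.
    by rewrite (bigD1 k) //= in e; apply/eqP; rewrite -addr_eq0 e.
  apply: in_gen_subfieldN; apply: in_gen_subfield_sum => s sk; apply: w_offdiag.
  by apply: contraNneq sk => -[->].
have [h [a [h0 ha]]] : exists h (a : 'I_n.+1 -> 'I_n.+1 -> 'I_n.+1 -> {mpoly K[n.+1]}),
    h != 0 /\ forall i j k, (h \mPo F) * mwronskian F c i j k = a i j k \mPo F.
  have w_frac (t : 'I_n.+1 * 'I_n.+1 * 'I_n.+1) : exists ha : {mpoly K[n.+1]} * {mpoly K[n.+1]},
      ha.1 != 0 /\ (ha.1 \mPo F) * mwronskian F c t.1.1 t.1.2 t.2 = ha.2 \mPo F.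
    have [h [a [h0 e]]] := in_gen_subfield_fraction inj_F (w_all t.1.1 t.1.2 t.2).
    exists (h, a); split=> //; apply/eqP; rewrite -tofrac_eq tofracM.
    by rewrite -e wE.
  have [ha hha] := fin_all_exists w_frac.
  (* The product of all denominators serves as a common one. *)
  exists (\prod_t (ha t).1), (fun i j k => (ha (i, j, k)).2 * \prod_(t | t != (i, j, k)) (ha t).1).
  split; first by apply/prodf_neq0 => t _; case: (hha t).
  move=> i j k; rewrite (bigD1 (i, j, k)) //= !comp_mpolyM mulrAC.
  by have [_ /= ->] := hha (i, j, k).
pose phi : {rmorphism {mpoly K[n.+1]} -> ratfun K n.+1} :=
  [the {rmorphism _ -> _} of @FracField.tofrac _ \o comp_mpoly F].
have inj_phi : injective phi.
  by move=> p q /eqP; rewrite /phi /= tofrac_eq => /eqP/inj_F.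
have [io ioF] := ratfun_lift inj_phi.
(* x_t is a polynomial lying in K(F), hence in K[F]. *)
have X_poly t : exists g, 'X_t = g \mPo F.
  have [x] := coordinate_in_generated charK0 c_neq0 detJ h0 ha ioF t.
  rewrite (frac_repr x) fmorph_div !ioF; have := denom_ratioP (repr x).
  move: (\n_(repr x)) (\d_(repr x)) => p q q0 /eqP.
  have qF0 : q \mPo F != 0 by rewrite -(comp_mpoly0 F) (inj_eq inj_F).
  rewrite -[X in _ == X]divr1 -tofrac1 eqr_div ?tofrac_eq0 ?oner_neq0 // -!tofracM.
  rewrite tofrac_eq mulr1 mulrC => /eqP/esym e.
  exact: (component_quotient_polynomial charK0 c_neq0 detJ q0 e).
have [G GF] : exists G : n.+1.-tuple {mpoly K[n.+1]}, forall i, tnth G i \mPo F = 'X_i.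
  have [g hg] := fin_all_exists X_poly.
  by exists [tuple g i | i < n.+1] => i; rewrite tnth_mktuple.
exists G; split; apply: cancel_polymap => // i.
(* F o G o F = F, and substitution of F is injective, so F o G is the identity as well. *)
apply: inj_F; rewrite comp_mpolyA comp_mpolyXU -tnth_nth -[RHS]comp_mpoly_id.
congr (_ \mPo _); apply: eq_from_tnth => j.
by rewrite !tnth_mktuple.
Qed.
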